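(* Let $a,b\in\mathbb{R}$, $\lambda>0$, and let $(\tilde X_n)_{n\ge -1}$ be an $\mathbb{N}$-valued process with initial condition $(\tilde X_0,\tilde X_{-1})\in\mathbb{N}^2$ such that for all $n\ge 1$, conditioned on $\tilde X_{-1},\ldots,\tilde X_{n-1}$, the random variable $\tilde X_n$ is Poisson distributed with parameter $(a\tilde X_{n-1}+b\tilde X_{n-2}+\lambda)_+$. Let $b_c:\mathbb{R}\to\mathbb{R}$ be given by $b_c(a)=1$ if $a\le 0$, $b_c(a)=1-a$ if $a\in(0,2)$, and $b_c(a)=-\frac{a^2}{4}$ if $a\ge 2$. Let $\mathcal{R}=\{(a,b)\in\mathbb{R}^2: b<b_c(a)\}$ and $\mathcal{T}=\{(a,b)\in\mathbb{R}^2: b>b_c(a)\}$. Then: \begin{itemize} \item If $(a,b)\in\mathcal{R}$, then the sequence $(\tilde X_n)_{n\ge 0}$ converges in law as $n\to\infty$. \item If $(a,b)\in\mathcal{T}$, then almost surely $\tilde X_n+\tilde X_{n+1}\to+\infty$ as $n\to\infty$. \end{itemize}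
   Context: $\mathbb{N}=\{0,1,2,\ldots\}$ and $(x)_+=\max(0,x)$. The Poisson distribution with parameter $0$ is the Dirac mass at $0$. *)

(* Defs.v *)
From mathcomp Require Import all_boot all_order all_algebra.
From mathcomp Require Import all_classical all_reals all_analysis.

Set Implicit Arguments.
Unset Strict Implicit.
Unset Printing Implicit Defensive.

Import Order.TTheory GRing.Theory Num.Theory.
Import numFieldNormedType.Exports.

Local Open Scope classical_set_scope.
Local Open Scope ring_scope.

(* [poisson_prob] carries a second, unused, natural number argument, and is
   the Dirac mass at 0 when [rate <= 0]; beware that [poisson_pmf rate] is not a
   mass function in that case. *)
Definition poisson_law (R : realType) (rate : R) : probability nat R :=
  poisson_prob rate 0.

(* Meaningful only when [P B != 0]. *)
Definition cond_prob d (T : measurableType d) (R : realType)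
    (P : probability T R) (A B : set T) : R :=
  fine (P (A `&` B)) / fine (P B).

(* Time is shifted by one: [X m] is the value of the process at time [m - 1],
   so the process is indexed by the times -1, 0, 1, 2, ... and [X m.+2] is the
   value at the time m + 1 >= 1. As the process has countable state space,
   conditioning on its past is conditioning on each history of positive
   probability; [h] lists the values taken up to time m. The initial values
   [X 0] and [X 1] are arbitrary, possibly random. *)
Definition is_poisson_autoregression d (T : measurableType d) (R : realType)
    (P : probability T R) (a b lambda : R) (X : nat -> {RV P >-> nat}) : Prop :=
  forall (m : nat) (h : nat -> nat),
    let past := [set w | forall i, (i <= m.+1)%N -> X i w = h i] in
    P past != 0%E ->
    forall A : set nat,
      (cond_prob P (X m.+2 @^-1` A) past)%:E =
      poisson_law (Num.max 0 (a * (h m.+1)%:R + b * (h m)%:R + lambda)) A.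
Arguments is_poisson_autoregression {d T R} P a b lambda X.

Definition b_c (R : realType) (a : R) : R :=
  if a <= 0 then 1 else if a < 2 then 1 - a else - (a ^+ 2 / 4).

Definition region_R (R : realType) : set (R * R) :=
  [set ab | ab.2 < b_c ab.1].

Definition region_T (R : realType) : set (R * R) :=
  [set ab | b_c ab.1 < ab.2].

(* On [nat], which is discrete, every function is continuous. *)
Definition cvg_in_law_to d (T : measurableType d) (R : realType)
    (P : probability T R) (Y : nat -> {RV P >-> nat}) (mu : probability nat R)
    : Prop :=
  forall f : nat -> R, continuous f -> bounded_fun f ->
    ('E_P[f \o Y n])%E @[n --> \oo] --> (\int[mu]_k (f k)%:E)%E.
Arguments cvg_in_law_to {d T R} P Y mu.

Definition cvg_in_law d (T : measurableType d) (R : realType)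
    (P : probability T R) (Y : nat -> {RV P >-> nat}) : Prop :=
  exists mu : probability nat R, cvg_in_law_to P Y mu.
Arguments cvg_in_law {d T R} P Y.

(* Main.v *)
(* Both halves follow from drift inequalities for functions of the pair
   (X_{n-1}, X_n), a Markov chain on N^2 that reaches (0, 0) in two steps from
   any state with positive probability.

   Transience: it is enough to have a bounded g with E g(next) <= g everywhere
   and strict inequality at (0, 0), because then the expected numbers of visits
   to (0, 0), hence to any given state, are finite, and Borel-Cantelli applies.
   Since E exp(-sZ) = exp(-(1-exp(-s))mu) for Z Poisson of parameter mu, one can
   take g = min(1, exp(-s(y-rx))) when a+b > 1 (with -b < r < a-1) or when a > 2
   and b > -a^2/4 (with r = a/2); when a < 0 < 1 < b, use the same exponential on
   the two axes and 1 elsewhere.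

   Recurrence: the noiseless dynamics (x, y) -> (y, (ay+bx)_+) is homogeneous and
   Lipschitz, and on the region R some iterate of it contracts the quadrant by a
   factor 1/2. Summing |.| along its orbit gives a Lipschitz Lyapunov function V,
   and the Poisson noise, of order sqrt(mu), does not destroy the drift. The
   two-step kernel then contracts the oscillation of functions relative to
   2 + beta V(v) + beta V(w) (Harris's theorem in the form of Hairer and
   Mattingly), so that E f(X_n) converges from every starting point to the same
   limit; tightness makes the limit a probability measure, and dominated
   convergence accounts for the random initial condition. *)
From HB Require Import structures.
Require Import Defs.
From mathcomp Require Import all_boot all_order all_algebra.
From mathcomp Require Import all_classical all_reals all_analysis.
From mathcomp Require Import measurable_realfun ring lra.

Set Implicit Arguments.
Unset Strict Implicit.
Unset Printing Implicit Defensive.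

Import Order.TTheory GRing.Theory Num.Theory.
Import numFieldNormedType.Exports.

Local Open Scope classical_set_scope.
Local Open Scope ring_scope.

(** * Poisson moments *)

Lemma ge0_integral_nat (R : realType) (nu : {measure set nat -> \bar R})
    (f : nat -> \bar R) :
  (forall k, 0 <= f k)%E ->
  (\int[nu]_k f k = \sum_(0 <= k <oo) nu [set k] * f k)%E.
Proof.
move=> f0; have -> : [set: nat] = \bigcup_k [set k].
  by apply/seteqP; split => // k _; exists k.
rewrite ge0_integral_bigcup//; last first.
  by apply/trivIsetP => i j _ _ ij; apply/seteqP; split => // k [/= -> /eqP];
    rewrite (negbTE ij).
apply: eq_eseriesr => k _.
rewrite (eq_integral (cst (f k))); last by move=> x; rewrite inE => ->.
by rewrite integral_cst// muleC.
Qed.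

(** Since [0 ^+ 0 = 1], the formula also gives the Dirac mass at 0 when [rate = 0], which
    [poisson_pmf] does not; a single expression thus covers every rate that occurs. *)
Definition poisson_mass (R : realType) (rate : R) k : R :=
  rate ^+ k * k`!%:R^-1 * expR (- rate).

Section PoissonMoments.
Context {R : realType}.
Implicit Types (rate : R) (f : nat -> R).

Lemma poisson_mass_ge0 rate k : 0 <= rate -> 0 <= poisson_mass rate k.
Proof. by move=> r0; rewrite !mulr_ge0 ?exprn_ge0 ?invr_ge0 ?expR_ge0. Qed.

Let mass_term_ge0 rate k (x : R) : 0 <= rate -> 0 <= x ->
  (0 <= (poisson_mass rate k)%:E * x%:E)%E.
Proof. by move=> r0 x0; rewrite -EFinM lee_fin mulr_ge0 ?poisson_mass_ge0. Qed.

Lemma poisson_law_set1 rate k : 0 <= rate ->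
  poisson_law rate [set k] = (poisson_mass rate k)%:E.
Proof.
rewrite /poisson_law/= le_eqVlt => /predU1P[<-|r0].
  rewrite /poisson_prob ltxx diracE /poisson_mass oppr0 expR0 mulr1 expr0n.
  case: k => [|k]; first by rewrite mem_set// eqxx fact0 invr1 mulr1.
  by rewrite memNset//= mul0r.
by rewrite /poisson_prob r0 esum_set1 ?lee_fin ?poisson_pmf_ge0// /poisson_pmf r0.
Qed.

Lemma ge0_integral_poisson rate (f : nat -> \bar R) : 0 <= rate ->
  (forall k, 0 <= f k)%E ->
  (\int[poisson_law rate]_k f k =
   \sum_(0 <= k <oo) (poisson_mass rate k)%:E * f k)%E.
Proof.
move=> r0 f0; rewrite ge0_integral_nat//.
by apply: eq_eseriesr => k _; congr (_ * _)%E; exact: poisson_law_set1.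
Qed.

Lemma ge0_poisson_stein_chen rate f : 0 <= rate -> (forall k, 0 <= f k) ->
  (\int[poisson_law rate]_k (k%:R * f k)%:E =
   rate%:E * \int[poisson_law rate]_k (f k.+1)%:E)%E.
Proof.
move=> r0 f0; rewrite !ge0_integral_poisson//; try by move=> k;
  rewrite lee_fin ?mulr_ge0.
rewrite nneseries_recl//; last first.
  by move=> k _; rewrite mass_term_ge0 ?mulr_ge0.
rewrite mul0r mule0 add0e -nneseriesZl; last first.
  by move=> k _; rewrite mass_term_ge0 ?mulr_ge0.
rewrite -[in LHS](add0n 1%N) -nneseries_addn; last first.
  by move=> k; rewrite mass_term_ge0 ?mulr_ge0.
apply: eq_eseriesr => k _; rewrite !addn1 -!EFinM; congr EFin.
rewrite /poisson_mass factS natrM invfM exprS.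
by field; rewrite ?gt_eqF ?ltr0n ?fact_gt0.
Qed.

Lemma integral_poisson_cst rate (c : R) :
  (\int[poisson_law rate]_k c%:E = c%:E)%E.
Proof.
rewrite integral_cst// -[RHS]mule1; congr (_ * _)%E; exact: probability_setT.
Qed.

Lemma integral_poisson_id rate : 0 <= rate ->
  (\int[poisson_law rate]_k k%:R%:E = rate%:E)%E.
Proof.
move=> r0; have := @ge0_poisson_stein_chen rate (fun=> 1) r0 (fun=> ler01).
rewrite integral_poisson_cst mule1 => <-.
by apply: eq_integral => k _; rewrite mulr1.
Qed.

Lemma integral_poisson_sqr rate : 0 <= rate ->
  (\int[poisson_law rate]_k (k%:R ^+ 2)%:E = (rate * (rate + 1))%:E)%E.
Proof.
move=> r0.
have := @ge0_poisson_stein_chen rate (fun k => k%:R) r0 (fun k => ler0n _ k).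
under eq_integral do rewrite -expr2.
move=> ->; under eq_integral do rewrite -natr1 EFinD.
rewrite ge0_integralD//=.
by rewrite integral_poisson_id// integral_poisson_cst -EFinD EFinM.
Qed.

(** Exponential tilting: weighting the masses by [expR (- (s * k))] gives, up to a constant factor,
    the masses for the rate [rate * expR (- s)], whose sum is 1. *)
Lemma integral_poisson_expR rate s : 0 <= rate ->
  (\int[poisson_law rate]_k (expR (- (s * k%:R)))%:E =
   (expR (- ((1 - expR (- s)) * rate)))%:E)%E.
Proof.
move=> r0; rewrite ge0_integral_poisson//.
have r1 : 0 <= rate * expR (- s) by rewrite mulr_ge0 ?expR_ge0.
have := integral_poisson_cst (rate * expR (- s)) 1.
rewrite ge0_integral_poisson// => /(congr1 (fun x =>
  (expR (- ((1 - expR (- s)) * rate)))%:E * x)%E).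
rewrite mule1 => <-; rewrite -nneseriesZl; last first.
  by move=> k _; rewrite mule1 lee_fin poisson_mass_ge0.
apply: eq_eseriesr => k _; rewrite mule1 -!EFinM; congr EFin.
rewrite /poisson_mass exprMn.
have -> : expR (- (s * k%:R)) = expR (- s) ^+ k.
  by rewrite -expRM_natr mulNr.
have -> : - rate = - ((1 - expR (- s)) * rate) + - (rate * expR (- s)) by ring.
by rewrite expRD; ring.
Qed.
End PoissonMoments.

(** * Real-valued Poisson expectations *)

Section PoissonExpectation.
Context {R : realType}.
Implicit Types (rate : R) (f g : nat -> R).

Definition poisson_mean rate f : R := (\int[poisson_law rate]_k f k)%R.

(** This growth guarantees integrability, so that [poisson_mean] is a true expectation and not the
    default value of [fine]. Squares are included for the sake of the variance. *)
Definition quadratic_growth f := exists A : R, forall k, `|f k| <= A * (1 + k%:R ^+ 2).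

Lemma bounded_quadratic_growth f A : (forall k, `|f k| <= A) ->
  quadratic_growth f.
Proof.
move=> fA; exists A => k; apply: (le_trans (fA k)).
rewrite ler_peMr ?lerDl ?sqr_ge0//; exact: le_trans (fA k).
Qed.

Lemma linear_quadratic_growth f A : (forall k, `|f k| <= A * (1 + k%:R)) ->
  quadratic_growth f.
Proof.
move=> fA; have A0 : 0 <= A.
  by have := le_trans (normr_ge0 _) (fA 0%N); rewrite addr0 mulr1.
exists (2 * A) => k; apply: (le_trans (fA k)); rewrite mulrAC mulrC ler_wpM2r//.
by have := sqr_ge0 (k%:R - 1 : R); nra.
Qed.

Lemma quadratic_growthD f g : quadratic_growth f -> quadratic_growth g ->
  quadratic_growth (f \+ g).
Proof.
move=> [A fA] [B gB]; exists (A + B) => k.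
by rewrite mulrDl (le_trans (ler_normD _ _))// lerD.
Qed.

Lemma quadratic_growthZ c f : quadratic_growth f ->
  quadratic_growth (fun k => c * f k).
Proof.
move=> [A fA]; exists (`|c| * A) => k.
by rewrite normrM -mulrA ler_wpM2l.
Qed.

Lemma integrable_poisson rate f : 0 <= rate -> quadratic_growth f ->
  (poisson_law rate).-integrable setT (EFin \o f).
Proof.
move=> r0 [A fA].
apply: (@le_integrable _ _ _ _ _ _ _ (fun k => (A * (1 + k%:R ^+ 2))%:E)) => //.
  move=> k _ /=; rewrite lee_fin (le_trans (fA k))// ler_norm//.
apply/integrableP; split => //.
under eq_integral do rewrite /= normrM EFinM.
rewrite ge0_integralZl//.
have -> : (\int[poisson_law rate]_k `|1 + k%:R ^+ 2|%:E =
    1 + (rate * (rate + 1))%:E)%E.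
  rewrite -integral_poisson_sqr// -(integral_poisson_cst rate 1).
  rewrite -ge0_integralD//.
  by apply: eq_integral => k _; rewrite -EFinD ger0_norm.
by rewrite -EFinD -EFinM ltry.
Qed.

Section Nonneg.
Variable rate : R.
Hypothesis r0 : 0 <= rate.

Lemma poisson_meanD f g : quadratic_growth f -> quadratic_growth g ->
  poisson_mean rate (fun k => f k + g k) = poisson_mean rate f + poisson_mean rate g.
Proof.
by move=> qf qg; rewrite /poisson_mean RintegralD//; exact: integrable_poisson.
Qed.

Lemma poisson_meanB f g : quadratic_growth f -> quadratic_growth g ->
  poisson_mean rate (fun k => f k - g k) = poisson_mean rate f - poisson_mean rate g.
Proof.
by move=> qf qg; rewrite /poisson_mean RintegralB//; exact: integrable_poisson.
Qed.

Lemma poisson_meanZ c f : quadratic_growth f ->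
  poisson_mean rate (fun k => c * f k) = c * poisson_mean rate f.
Proof.
by move=> qf; rewrite /poisson_mean RintegralZl//; exact: integrable_poisson.
Qed.

Lemma poisson_mean_cst c : poisson_mean rate (fun=> c) = c.
Proof. by rewrite /poisson_mean /Rintegral integral_poisson_cst. Qed.

Lemma poisson_mean_id : poisson_mean rate (fun k => k%:R) = rate.
Proof. by rewrite /poisson_mean /Rintegral integral_poisson_id. Qed.

Lemma poisson_mean_sqr :
  poisson_mean rate (fun k => k%:R ^+ 2) = rate * (rate + 1).
Proof. by rewrite /poisson_mean /Rintegral integral_poisson_sqr. Qed.

Lemma poisson_mean_expR s :
  poisson_mean rate (fun k => expR (- (s * k%:R))) =
  expR (- ((1 - expR (- s)) * rate)).
Proof. by rewrite /poisson_mean /Rintegral integral_poisson_expR. Qed.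

Lemma le_poisson_mean f g : quadratic_growth f -> quadratic_growth g ->
  (forall k, f k <= g k) -> poisson_mean rate f <= poisson_mean rate g.
Proof.
by move=> qf qg fg; apply: le_Rintegral => //; exact: integrable_poisson.
Qed.

Lemma poisson_mean_ge_mass f j : quadratic_growth f -> (forall k, 0 <= f k) ->
  poisson_mass rate j * f j <= poisson_mean rate f.
Proof.
move=> qf f0; rewrite -lee_fin /poisson_mean /Rintegral fineK; last first.
  by apply: integrable_fin_num => //; exact: integrable_poisson.
rewrite ge0_integral_poisson// EFinM.
have t0 k : (0 <= (poisson_mass rate k)%:E * (f k)%:E)%E.
  by rewrite -EFinM lee_fin mulr_ge0 ?poisson_mass_ge0.
by rewrite (@nneseriesD1 _ _ j)// leeDl// nneseries_ge0.
Qed.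

End Nonneg.
End PoissonExpectation.

(** * The Markov property *)

Section Fibers.
Context d (T : measurableType d) (R : realType) (mu : {measure set T -> \bar R}).
Implicit Types (D : set T) (U V : {mfun T >-> nat}).

Lemma measurable_fiber U k : measurable (U @^-1` [set k]).
Proof. exact: measurable_funPTI. Qed.

Lemma fiber_bigcup D U : D = \bigcup_k (D `&` U @^-1` [set k]).
Proof. by apply/seteqP; split => [w Dw|w [k _ []//]]; exists (U w). Qed.

Lemma trivIset_fiber D U : trivIset setT (fun k => D `&` U @^-1` [set k]).
Proof.
apply/trivIsetP => i j _ _ ij; apply/seteqP; split => // w [[_ /= wi] [_ /= wj]].
by move: ij; rewrite -wi -wj eqxx.
Qed.

Lemma measure_fibers D U : measurable D ->
  (mu D = \sum_(0 <= k <oo) mu (D `&` U @^-1` [set k]))%E.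
Proof.
move=> mD; rewrite [in LHS](fiber_bigcup D U) measure_bigcup//.
- by apply: eq_eseriesl => i; rewrite in_setT.
- by move=> k _; apply: measurableI => //; exact: measurable_fiber.
- exact: trivIset_fiber.
Qed.

Lemma ge0_integral_fibers D U (F : T -> \bar R) : measurable D ->
    measurable_fun setT F -> (forall w, 0 <= F w)%E ->
  (\int[mu]_(w in D) F w =
   \sum_(0 <= k <oo) \int[mu]_(w in D `&` U @^-1` [set k]) F w)%E.
Proof.
move=> mD mF F0; rewrite [in LHS](fiber_bigcup D U) ge0_integral_bigcup//.
- by move=> k; apply: measurableI => //; exact: measurable_fiber.
- exact: measurable_funTS.
- exact: trivIset_fiber.
Qed.

Lemma measurable_fun_fibers2 d' (T' : measurableType d') (g : nat -> nat -> T') U V :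
  measurable_fun setT (fun w => g (U w) (V w)).
Proof.
move=> _ Y mY; rewrite setTI.
rewrite (_ : _ @^-1` Y = \bigcup_x \bigcup_(y in [set y | Y (g x y)])
    (U @^-1` [set x] `&` V @^-1` [set y])); last first.
  apply/seteqP; split => [w Yw|w [x _ [y /= Yxy [/= -> ->]]]//].
  by exists (U w) => //; exists (V w).
apply: bigcup_measurable => x _; apply: bigcup_measurable => y _.
by apply: measurableI; exact: measurable_fiber.
Qed.

End Fibers.

Section Process.
Context {R : realType} (a b lambda : R).
Implicit Types (f g : nat -> nat -> R).

(* the argument order is chronological: [x] comes before [y] *)
Definition intensity (x y : nat) : R := Num.max 0 (a * y%:R + b * x%:R + lambda).

(** The transition operator of the pair chain: (x, y) is followed by (y, z) with z Poisson, so the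
    first argument of [f] becomes [y]. *)
Definition step f (x y : nat) : R := poisson_mean (intensity x y) (f y).

Lemma intensity_ge0 x y : 0 <= intensity x y.
Proof. by rewrite le_max lexx. Qed.

Context d (T : measurableType d) (P : probability T R) (X : nat -> {RV P >-> nat}).
Hypothesis HX : is_poisson_autoregression P a b lambda X.

(** For [j = 0] this is the event [past] of the hypothesis; for [j = m] it fixes only the last two
    values. *)
Let agree m j (h : nat -> nat) :=
  [set w | forall i, (j <= i <= m.+1)%N -> X i w = h i].

Let measurable_agree m j h : measurable (agree m j h).
Proof.
rewrite (_ : agree m j h = \bigcap_(i in [set i | (j <= i <= m.+1)%N])
  (X i @^-1` [set h i])); last by apply/seteqP; split.
by apply: bigcap_measurableType => i _; exact: measurable_fiber.
Qed.

(** Induction on [j]: the oldest prescribed value is forgotten by summing over the fibers of [X j],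
    and the Poisson factor comes out of the sum because it depends on the last two values only. At
    [j = 0], a null past makes both sides vanish, and any other past is covered by the
    hypothesis. *)
Let joint_agree m j h A : (j <= m)%N ->
  P (agree m j h `&` X m.+2 @^-1` A) =
  (P (agree m j h) * poisson_law (intensity (h m) (h m.+1)) A)%E.
Proof.
have mA : measurable (X m.+2 @^-1` A) by exact: measurable_funPTI.
elim: j h => [|j IH] h jm.
  have [P0|P0] := eqVneq (P (agree m 0 h)) 0%E.
    rewrite P0 mul0e; apply/eqP; rewrite -measure_le0 -P0 le_measure ?inE//.
    by apply: measurableI => //; exact: measurable_agree.
  have := HX P0 A; rewrite /cond_prob -/(agree m 0 h) setIC => <-.
  rewrite -[X in (X * _)%E]fineK ?fin_num_measure// -EFinM mulrC divfK.
    by rewrite fineK// fin_num_measure//; exact: measurableI.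
  by rewrite fine_eq0 ?fin_num_measure.
(* [hk k] prescribes in addition the value [k] at index [j]. As [j < m], the entries at [m] and
   [m.+1], hence the intensity, are unchanged. *)
pose hk k i := if i == j then k else h i.
have agreeS k : agree m j.+1 h `&` X j @^-1` [set k] = agree m j (hk k).
  apply/seteqP; split => w.
    move=> [wh /= wk] i /andP[ji im]; rewrite /hk.
    by have [->//|ij] := eqVneq i j; rewrite wh// im ltn_neqAle eq_sym ij ji.
  move=> wh; split.
    move=> i /andP[ji im]; have jim : (j <= i <= m.+1)%N by rewrite im ltnW.
    by rewrite (wh i jim) /hk gtn_eqF.
  have jjm : (j <= j <= m.+1)%N by rewrite leqnn (leq_trans (ltnW jm)).
  by rewrite /= (wh j jjm) /hk eqxx.
rewrite (measure_fibers P (X j)); last exact: measurableI.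
rewrite (measure_fibers P (X j) (measurable_agree m j.+1 h)).
rewrite -[X in (_ * X)%E]fineK; last first.
  exact: fin_num_measure.
rewrite muleC -nneseriesZl//.
apply: eq_eseriesr => k _.
rewrite setIAC agreeS; apply: (etrans (IH (hk k) (ltnW jm))).
have jm' : (j < m.+1)%N by exact: leqW.
have [-> ->] : hk k m = h m /\ hk k m.+1 = h m.+1.
  by rewrite /hk (gtn_eqF jm) (gtn_eqF jm').
rewrite muleC; congr (_ * _)%E; apply/esym/fineK; exact: fin_num_measure.
Qed.

Lemma joint_law m x y A :
  P (X m @^-1` [set x] `&` X m.+1 @^-1` [set y] `&` X m.+2 @^-1` A) =
  (P (X m @^-1` [set x] `&` X m.+1 @^-1` [set y]) *
   poisson_law (intensity x y) A)%E.
Proof.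
pose h i := if i == m then x else y.
have <- : agree m m h = X m @^-1` [set x] `&` X m.+1 @^-1` [set y].
  apply/seteqP; split => w.
    move=> wh; split; rewrite /= wh ?leqnn ?leqnSn// /h ?eqxx// gtn_eqF//.
  move=> [/= wx wy] i /andP[mi im]; rewrite /h.
  have [->//|ne] := eqVneq i m.
  have -> // : i = m.+1 by apply/eqP; rewrite eqn_leq im ltn_neqAle eq_sym ne.
apply: (etrans (joint_agree h A (leqnn m))).
congr (_ * poisson_law (intensity _ _) _)%E.
  by rewrite /h eqxx.
by rewrite /h (gtn_eqF (ltnSn m)).
Qed.

(** The sample space is cut along the values of [X n], [X n.+1] and, on the left, [X n.+2]. The
    integrands are constant on the pieces, and [joint_law] gives the measure of each piece. *)
Lemma ge0_integral_step n f : (forall x y, 0 <= f x y) ->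
    (exists A, forall x y, f x y <= A) ->
  (\int[P]_w (f (X n.+1 w) (X n.+2 w))%:E =
   \int[P]_w (step f (X n w) (X n.+1 w))%:E)%E.
Proof.
move=> f0 [A fA].
have qf y : quadratic_growth (f y).
  by apply: (@bounded_quadratic_growth _ _ A) => z; rewrite ger0_norm.
have s0 x y : 0 <= step f x y by apply: Rintegral_ge0.
have mF := measurable_fun_fibers2 (fun x y => (f x y)%:E) (X n.+1) (X n.+2).
have mG := measurable_fun_fibers2 (fun x y => (step f x y)%:E) (X n) (X n.+1).
rewrite (ge0_integral_fibers P (X n) measurableT mF)//; last first.
  by move=> w; rewrite lee_fin.
rewrite (ge0_integral_fibers P (X n) measurableT mG)//; last first.
  by move=> w; rewrite lee_fin.
apply: eq_eseriesr => x _; rewrite setTI.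
have mx : measurable (X n @^-1` [set x]) by exact: measurable_fiber.
rewrite (ge0_integral_fibers P (X n.+1) mx mF)//; last first.
  by move=> w; rewrite lee_fin.
rewrite (ge0_integral_fibers P (X n.+1) mx mG)//; last first.
  by move=> w; rewrite lee_fin.
apply: eq_eseriesr => y _.
set D := _ `&` _.
have mD : measurable D by apply: measurableI => //; exact: measurable_fiber.
rewrite (ge0_integral_fibers P (X n.+2) mD mF)//; last first.
  by move=> w; rewrite lee_fin.
rewrite [RHS](@eq_integral _ _ _ _ _ (cst (step f x y)%:E)); last first.
  by move=> w; rewrite inE => -[/= -> ->].
rewrite integral_cst// /step /poisson_mean /Rintegral fineK; last first.
  by apply: integrable_fin_num => //; apply: integrable_poisson => //; exact: intensity_ge0.
rewrite ge0_integral_nat; last by move=> k; rewrite lee_fin.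
rewrite [RHS]muleC -[X in _ = (X * _)%E]fineK; last exact: fin_num_measure.
rewrite -nneseriesZl; last first.
  by move=> k _; rewrite mule_ge0// lee_fin.
apply: eq_eseriesr => z _.
have mz : measurable (D `&` X n.+2 @^-1` [set z]).
  by apply: measurableI => //; exact: measurable_fiber.
rewrite (@eq_integral _ _ _ _ _ (cst (f y z)%:E)); last first.
  by move=> w; rewrite inE => -[[/= _ ->] ->].
rewrite integral_cst// muleC.
rewrite [X in (X * _)%E = _](_ : _ = P D * poisson_law (intensity x y) [set z])%E.
  by rewrite fineK ?muleA//; exact: fin_num_measure.
exact: joint_law.
Qed.

End Process.

Section BoundedMeans.
Context {R : realType} (a b lambda : R).
Context d (T : measurableType d) (P : probability T R) (X : nat -> {RV P >-> nat}).
Implicit Types (f g : nat -> nat -> R).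
Local Notation step := (step a b lambda).

Definition bounded2 f := exists A : R, forall x y, `|f x y| <= A.

Definition pair_mean n f : R := (\int[P]_w f (X n w) (X n.+1 w))%R.

Lemma bounded2_integrable n f : bounded2 f ->
  P.-integrable setT (EFin \o (fun w => f (X n w) (X n.+1 w))).
Proof.
move=> [A fA]; apply: measurable_bounded_integrable => //.
- by apply: (le_lt_trans (probability_le1 P measurableT)); rewrite ltry.
- exact: measurable_fun_fibers2.
- exists A; split; first exact: num_real.
  by move=> B AB w _ /=; rewrite (le_trans (fA _ _))// ltW.
Qed.

Lemma bounded2_growth f x : bounded2 f -> quadratic_growth (f x).
Proof. by move=> [A fA]; exact: (@bounded_quadratic_growth _ _ A). Qed.

Lemma bounded2_step f : bounded2 f -> bounded2 (step f).
Proof.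
move=> bf; have [A fA] := bf; exists A => x y; rewrite /step ler_norml.
have I0 := intensity_ge0 a b lambda x y.
rewrite -[X in X <= _ <= _](poisson_mean_cst (intensity a b lambda x y)).
rewrite -[X in _ <= _ <= X](poisson_mean_cst (intensity a b lambda x y)).
have qc c : quadratic_growth (fun=> c : R).
  exact: (@bounded_quadratic_growth _ _ `|c|).
apply/andP; split; apply: le_poisson_mean => //; try exact: bounded2_growth;
  by move=> k; have := fA y k; rewrite ler_norml => /andP[].
Qed.

Lemma bounded2D f g : bounded2 f -> bounded2 g ->
  bounded2 (fun x y => f x y + g x y).
Proof.
move=> [A fA] [B gB]; exists (A + B) => x y.
by rewrite (le_trans (ler_normD _ _))// lerD.
Qed.

Lemma bounded2Z c f : bounded2 f -> bounded2 (fun x y => c * f x y).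
Proof.
by move=> [A fA]; exists (`|c| * A) => x y; rewrite normrM ler_wpM2l.
Qed.

Lemma bounded2_cst c : bounded2 (fun _ _ => c).
Proof. by exists `|c|. Qed.

Lemma pair_meanD n f g : bounded2 f -> bounded2 g ->
  pair_mean n (fun x y => f x y + g x y) = pair_mean n f + pair_mean n g.
Proof.
by move=> bf bg; rewrite /pair_mean RintegralD//; exact: bounded2_integrable.
Qed.

Lemma pair_meanZ n c f : bounded2 f ->
  pair_mean n (fun x y => c * f x y) = c * pair_mean n f.
Proof.
by move=> bf; rewrite /pair_mean RintegralZl//; exact: bounded2_integrable.
Qed.

Lemma pair_mean_cst n c : pair_mean n (fun _ _ => c) = c.
Proof.
rewrite /pair_mean Rintegral_cst// -[RHS]mulr1; congr (_ * _).
exact: (congr1 fine (probability_setT P)).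
Qed.

Lemma le_pair_mean n f g : bounded2 f -> bounded2 g ->
  (forall x y, f x y <= g x y) -> pair_mean n f <= pair_mean n g.
Proof.
by move=> bf bg fg; apply: le_Rintegral => //; exact: bounded2_integrable.
Qed.

Hypothesis HX : is_poisson_autoregression P a b lambda X.

Lemma pair_meanS n f : bounded2 f ->
  pair_mean n.+1 f = pair_mean n (step f).
Proof.
(* Nonnegative functions come first; adding the bound [A] reduces the general case to them, since
   [step] fixes constants. *)
have key g : bounded2 g -> (forall x y, 0 <= g x y) ->
    pair_mean n.+1 g = pair_mean n (step g).
  move=> [A gA] g0; congr fine; apply: (ge0_integral_step HX) => //.
  by exists A => x y; rewrite (le_trans (ler_norm _)).
move=> bf; have [A fA] := bf.
pose g x y := f x y + A.
have bg : bounded2 g by apply: bounded2D => //; exact: bounded2_cst.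
have g0 x y : 0 <= g x y.
  by have := fA x y; rewrite ler_norml /g => /andP[]; lra.
have := key _ bg g0; rewrite /g pair_meanD//; last exact: bounded2_cst.
have -> : step g = (fun x y => step f x y + A).
  apply/funext => x; apply/funext => y.
  rewrite /step /g poisson_meanD ?poisson_mean_cst ?intensity_ge0//.
    exact: bounded2_growth.
  exact: (@bounded2_growth (fun=> fun=> A) 0%N (bounded2_cst _)).
rewrite pair_meanD ?pair_mean_cst//; last exact: bounded2_cst.
  exact: addIr.
exact: bounded2_step.
Qed.

End BoundedMeans.

(** * Transience *)

Section Transience.
Context {R : realType} (a b lambda : R).
Context d (T : measurableType d) (P : probability T R) (X : nat -> {RV P >-> nat}).
Hypothesis HX : is_poisson_autoregression P a b lambda X.
Local Notation step := (step a b lambda).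
Local Notation intensity := (intensity a b lambda).

Let visit x y n := X n @^-1` [set x] `&` X n.+1 @^-1` [set y].

Let measurable_visit x y n : measurable (visit x y n).
Proof. by apply: measurableI; exact: measurable_fiber. Qed.

Let at_zero (x y : nat) : R := ((x == 0) && (y == 0))%N%:R.

Let bounded2_at_zero : bounded2 at_zero.
Proof. by exists 1 => x y; rewrite /at_zero; case: (_ && _); rewrite ?normr0 ?normr1. Qed.

Let pair_mean_at_zero n : (pair_mean X n at_zero)%:E = P (visit 0%N 0%N n).
Proof.
rewrite /pair_mean /Rintegral fineK; last first.
  by apply: integrable_fin_num => //; exact: bounded2_integrable.
rewrite (eq_integral (EFin \o \1_(visit 0%N 0%N n))).
  by rewrite integral_indic// setIT.
move=> w _ /=; congr EFin; rewrite /at_zero indicE; congr (nat_of_bool _)%:R.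
apply/idP/idP => [/andP[/eqP x0 /eqP y0]|]; first by rewrite inE.
by rewrite inE => -[/= -> ->].
Qed.

(** The means of [g] along the chain are bounded and nonincreasing, and drop at each time by at
    least [e] times the probability of being at (0, 0). Telescoping bounds the expected number of
    visits to (0, 0) by [2 * A / e]; dividing by [c] gives a bound for visits to (x, y). *)
Lemma superharmonic_visit_sum (g : nat -> nat -> R) x y :
    bounded2 g -> (forall x y, step g x y <= g x y) ->
    step g 0 0 < g 0%N 0%N ->
  (\sum_(0 <= n <oo) P (visit x y n) < +oo)%E.
Proof.
move=> bg sg sg0; have [A gA] := bg.
pose e := g 0%N 0%N - step g 0 0; have e0 : 0 < e by rewrite subr_gt0.
have decr n : e * pair_mean X n at_zero <= pair_mean X n g - pair_mean X n.+1 g.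
  rewrite (pair_meanS HX)// lerBrDr -pair_meanZ// -pair_meanD//; first last.
  - exact: bounded2_step.
  - exact: bounded2Z.
  apply: le_pair_mean => //.
    by apply: bounded2D; [exact: bounded2Z|exact: bounded2_step].
  move=> [|x'] [|y']; rewrite /at_zero /= ?mulr1 ?mulr0 ?add0r//.
  by rewrite /e subrK.
have boundg n : `|pair_mean X n g| <= A.
  have bc c : bounded2 (fun _ _ => c : R) by exact: bounded2_cst.
  rewrite ler_norml -[X in X <= _ <= _](pair_mean_cst X n).
  rewrite -[X in _ <= _ <= X](pair_mean_cst X n).
  by apply/andP; split; apply: le_pair_mean => // i j;
    have := gA i j; rewrite ler_norml => /andP[].
have sum0 N : \sum_(0 <= n < N) pair_mean X n at_zero <= 2 * A / e.
  rewrite ler_pdivlMr// mulrC mulr_sumr.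
  apply: (@le_trans _ _ (pair_mean X 0 g - pair_mean X N g)).
    rewrite -[leRHS]opprB.
    rewrite -(telescope_sumr (fun n => pair_mean X n g) (leq0n N)) -sumrN ler_sum// => n _.
    by rewrite opprB.
  have := boundg 0%N; have := boundg N; rewrite !ler_norml => /andP[? ?] /andP[? ?].
  by lra.
(* The probability of two zero values in a row, along the path from (x, y) through (y, 0) to (0,
   0). *)
pose c := poisson_mass (intensity x y) 0 * poisson_mass (intensity y 0) 0.
have c0 : 0 < c by rewrite /c /poisson_mass !expr0 fact0 invr1 !mul1r mulr_gt0 ?expR_gt0.
have visitS n : (c%:E * P (visit x y n) <= P (visit 0%N 0%N n.+2))%E.
  have m0 u v : poisson_law (intensity u v) [set 0%N] =
      (poisson_mass (intensity u v) 0)%:E.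
    by rewrite poisson_law_set1 ?intensity_ge0.
  have J1 := joint_law HX n x y [set 0%N].
  have J2 := joint_law HX n.+1 y 0%N [set 0%N].
  rewrite m0 in J1; rewrite m0 in J2.
  apply: (@le_trans _ _ (P (visit y 0%N n.+1 `&` X n.+3 @^-1` [set 0%N]))).
    rewrite [leRHS]J2 EFinM [leLHS]muleC muleA.
    apply: lee_wpmul2r; first by rewrite lee_fin poisson_mass_ge0 ?intensity_ge0.
    rewrite -[leLHS]J1; apply: le_measure; rewrite ?inE.
    - by apply: measurableI; [exact: measurable_visit|exact: measurable_fiber].
    - exact: measurable_visit.
    - by move=> w [[]].
  apply: le_measure; rewrite ?inE.
  - by apply: measurableI; [exact: measurable_visit|exact: measurable_fiber].
  - exact: measurable_visit.
  - by move=> w [[]].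
have bound : (\sum_(0 <= n <oo) P (visit x y n) <= (2 * A / e / c)%:E)%E.
  apply: lime_le; first by apply: is_cvg_nneseries.
  apply: nearW => N; rewrite [leLHS](_ : _ =
      (c^-1)%:E * (c%:E * \sum_(0 <= n < N) P (visit x y n)))%E; last first.
    by rewrite muleA -EFinM mulVf ?mul1e// lt0r_neq0.
  rewrite [leRHS](_ : _ = (c^-1)%:E * (2 * A / e)%:E)%E; last first.
    by rewrite -EFinM mulrC.
  apply: lee_wpmul2l; first by rewrite lee_fin invr_ge0 ltW.
  rewrite ge0_sume_distrr//.
  apply: (@le_trans _ _ (\sum_(0 <= n < N) P (visit 0%N 0%N n.+2))%E).
    exact: lee_sum.
  apply: (@le_trans _ _ (\sum_(0 <= n < N.+2) P (visit 0%N 0%N n))%E).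
    rewrite [leRHS]big_nat_recl// [X in (_ + X)%E]big_nat_recl// addeA.
    by rewrite leeDr// adde_ge0.
  under eq_bigr do rewrite -pair_mean_at_zero.
  by rewrite sumEFin lee_fin.
by apply: (le_lt_trans bound); rewrite ltry.
Qed.

(** Borel-Cantelli is applied to each of the countably many states. Outside the exceptional set
    every state is left for good, and the sum of the two values can be less than [M] only at the
    finitely many states with both entries below [M]. *)
Lemma superharmonic_transience (g : nat -> nat -> R) :
    bounded2 g -> (forall x y, step g x y <= g x y) ->
    step g 0 0 < g 0%N 0%N ->
  {ae P, forall w, (X n.+1 w + X n.+2 w)%N @[n --> \oo] --> \oo}.
Proof.
move=> bg sg sg0.
have neg : P.-negligible (\bigcup_x \bigcup_y lim_sup_set (visit x y)).
  apply: negligible_bigcup => x; apply: negligible_bigcup => y.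
  have m : measurable (lim_sup_set (visit x y)).
    by apply: bigcapT_measurable => n; exact: bigcup_measurable.
  apply/negligibleP => //; apply: lim_sup_set_cvg0 => //.
  exact: (superharmonic_visit_sum x y bg sg sg0).
apply: negligibleS neg => w /= nw; apply: contrapT => nlim; apply: nw.
apply/cvgnyPge => M.
have finite_visit x y : \forall n \near \oo, ~ visit x y n.+1 w.
  apply: contrapT => nv; apply: nlim; exists x => //; exists y => // n _ /=.
  apply: contrapT => nj; apply: nv; exists n => // k /= nk vk.
  by apply: nj; exists k.+1 => //=; exact: leqW.
have : \forall n \near \oo, forall x y : 'I_M, ~ visit x y n.+1 w.
  by apply: filter_forall => x; apply: filter_forall => y.
apply: filterS => n nv; rewrite leqNgt; apply/negP => lt.
have xM := leq_ltn_trans (leq_addr (X n.+2 w) (X n.+1 w)) lt.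
have yM := leq_ltn_trans (leq_addl (X n.+1 w) (X n.+2 w)) lt.
exact: (nv (Ordinal xM) (Ordinal yM)).
Qed.

End Transience.

(** * Bounded superharmonic functions on the transient region *)

Section SuperharmonicFunctions.
Context {R : realType} (a b lambda : R) (lambda_gt0 : 0 < lambda).
Local Notation step := (step a b lambda).
Local Notation intensity := (intensity a b lambda).
Implicit Types g : nat -> nat -> R.

Lemma intensity_ge x y : a * y%:R + b * x%:R + lambda <= intensity x y.
Proof. by rewrite le_max lexx orbT. Qed.

Lemma step_le g c x y : bounded2 g -> (forall z, g y z <= c) -> step g x y <= c.
Proof.
move=> bg gc; rewrite -[leRHS](poisson_mean_cst (intensity x y)).
apply: le_poisson_mean => //; first exact: intensity_ge0.
- exact: bounded2_growth.
- exact: (@bounded_quadratic_growth _ _ `|c|).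
Qed.

Lemma bounded2_itv01 g : (forall x y, 0 <= g x y <= 1) -> bounded2 g.
Proof.
by move=> g01; exists 1 => x y; have /andP[g0 g1] := g01 x y; rewrite ger0_norm.
Qed.

(** At (0, 0) the intensity is [lambda > 0], so every value [z] has positive mass and a single one
    with [g 0 z < 1] makes the inequality strict. *)
Lemma step00_lt1 g z : (forall x y, 0 <= g x y <= 1) -> g 0%N z < 1 ->
  step g 0 0 < 1.
Proof.
move=> g01 gz; have bg := bounded2_itv01 g01.
have I0 := intensity_ge0 a b lambda 0 0.
have qc : quadratic_growth (fun=> 1 : R).
  by apply: (@bounded_quadratic_growth _ _ 1) => k; rewrite normr1.
have q : quadratic_growth (fun k => 1 - g 0%N k).
  apply: (@bounded_quadratic_growth _ _ 1) => k.
  by have /andP[? ?] := g01 0%N k; rewrite ler_norml; lra.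
have g1 k : 0 <= 1 - g 0%N k by have /andP[_ ?] := g01 0%N k; rewrite subr_ge0.
have := poisson_mean_ge_mass I0 z q g1.
rewrite poisson_meanB//; last exact: bounded2_growth.
rewrite poisson_mean_cst -/(step g 0 0) => h.
rewrite -subr_gt0; apply: lt_le_trans h; rewrite mulr_gt0 ?subr_gt0//.
have -> : intensity 0 0 = lambda.
  by rewrite /intensity !mulr0 !add0r; apply/max_idPr/ltW.
by rewrite /poisson_mass !mulr_gt0 ?exprn_gt0 ?expR_gt0// invr_gt0 ltr0n fact_gt0.
Qed.

(** From [expR s >= 1 + s = k^-1] one gets [expR (- s) <= k], while [k * s = 1 - k]. So the exponent
    [1 - expR (- s)] of the Laplace transform is linear in [s] up to a factor [k], which may be
    taken close to 1. *)
Lemma onem_expRN_ge (k s : R) : 0 < k -> s = k^-1 - 1 -> 0 <= s ->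
  k * s <= 1 - expR (- s).
Proof.
move=> k0 sE s0; have -> : k * s = 1 - k by rewrite sE mulrBr divff ?gt_eqF ?mulr1.
rewrite lerB// expRN -[leRHS]invrK lef_pV2 ?posrE ?expR_gt0 ?invr_gt0//.
by have := expR_ge1Dx s; rewrite sE addrC subrK.
Qed.

(** The Laplace transform makes the exponent linear in the intensity, and [onem_expRN_ge] replaces
    [1 - expR (- s)] by [k * s]. The positive part and [lambda] can only raise the intensity, so
    they are dropped. *)
Lemma step_le_expR g (k s p : R) x y : bounded2 g ->
  0 < k < 1 -> s = k^-1 - 1 -> (forall z, g y z <= expR (- (s * (z%:R - p)))) ->
  step g x y <= expR (- (s * (k * (a * y%:R + b * x%:R) - p))).
Proof.
move=> bg /andP[k0 k1] sE gexp.
have s0 : 0 <= s by rewrite sE subr_ge0 ltW// invf_gt1.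
have I0 := intensity_ge0 a b lambda x y.
have q : quadratic_growth (fun z => expR (- (s * z%:R)) : R).
  apply: (@bounded_quadratic_growth _ _ 1) => z.
  by rewrite ger0_norm ?expR_ge0// expR_le1 oppr_le0 mulr_ge0.
have E z : expR (- (s * (z%:R - p))) = expR (s * p) * expR (- (s * z%:R)).
  by rewrite -expRD; congr expR; ring.
apply: (@le_trans _ _ (expR (s * p) * expR (- ((1 - expR (- s)) * intensity x y)))).
  rewrite -poisson_mean_expR// -poisson_meanZ//.
  apply: le_poisson_mean => //; first exact: bounded2_growth.
    exact: quadratic_growthZ.
  by move=> z; rewrite -E.
rewrite -expRD ler_expR.
have h1 := onem_expRN_ge k0 sE s0.
have h2 : k * s * intensity x y <= (1 - expR (- s)) * intensity x y by rewrite ler_wpM2r.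
have h3 : k * s * (a * y%:R + b * x%:R + lambda) <= k * s * intensity x y.
  by rewrite ler_wpM2l ?intensity_ge// mulr_ge0// ltW.
have h4 : 0 <= k * s * lambda by rewrite !mulr_ge0 ?(ltW k0) ?(ltW lambda_gt0).
nra.
Qed.

(** The assumption says that [y - r * x] does not decrease on the cone [r * x < y] when the next
    value is [k] times its noiseless mean. Off the cone the truncation makes [g] equal to 1, its
    maximum. *)
Lemma cone_superharmonic (k r : R) : 0 < k < 1 ->
    (forall x y : nat, r * x%:R < y%:R ->
      (r + 1) * y%:R - r * x%:R <= k * (a * y%:R + b * x%:R) :> R) ->
  exists g, [/\ bounded2 g, forall x y, step g x y <= g x y &
    step g 0 0 < g 0%N 0%N].
Proof.
move=> k01 cone; have /andP[k0 k1] := k01.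
pose s := k^-1 - 1; have s0 : 0 < s by rewrite subr_gt0 invf_gt1.
pose h (x y : nat) := expR (- (s * (y%:R - r * x%:R))).
pose g x y := Num.min 1 (h x y).
have g01 x y : 0 <= g x y <= 1.
  by rewrite ge_min lexx le_min ler01 expR_ge0.
have bg := bounded2_itv01 g01.
exists g; split => //.
- move=> x y; rewrite {2}/g le_min; apply/andP; split.
    by apply: step_le => // z; have /andP[] := g01 y z.
  have [yx|yx] := lerP y%:R (r * x%:R).
    apply: (@le_trans _ _ 1).
      by apply: step_le => // z; have /andP[] := g01 y z.
    by rewrite -expR0 ler_expR oppr_ge0 mulr_ge0_le0 ?(ltW s0)// subr_le0.
  apply: (le_trans (@step_le_expR g k s (r * y%:R) x y bg k01 erefl _)).
    by move=> z; rewrite ge_min lexx orbT.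
  rewrite ler_expR lerN2 ler_wpM2l ?(ltW s0)//.
  by have := cone x y yx; lra.
- have -> : g 0%N 0%N = 1.
    by rewrite /g /h mulr0 subrr mulr0 oppr0 expR0 minxx.
  apply: (@step00_lt1 _ 1) => //.
  by rewrite gt_min /h mulr0 subr0 mulr1 expR_lt1 oppr_lt0 s0 orbT.
Qed.

(** From (0, y) with [y] large the next value is 0, because [a < 0]; from (x, 0) the next value is
    about [b * x], which exceeds [x]. The chain thus tends to alternate between the axes while
    growing, and [g] measures the size on the axes only. *)
Lemma axes_superharmonic : a < 0 -> 1 < b ->
  exists g, [/\ bounded2 g, forall x y, step g x y <= g x y &
    step g 0 0 < g 0%N 0%N].
Proof.
move=> a0 b1.
(* From [y0] on, the intensity at (0, y) is zero; [phi] is shifted so as to equal 1 up to [y0],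
   where superharmonicity on the axes is trivial. *)
have [y0 hy0] : exists y0 : nat, a * y0%:R + lambda <= 0.
  exists (Num.truncn (lambda / - a)).+1.
  have := truncnS_gt (lambda / - a).
  by rewrite ltr_pdivrMr ?oppr_gt0// => /ltW; lra.
(* With [k * b = 1] the exponent obtained from (x, 0) is exactly that of [h x]. *)
pose k := b^-1; have k01 : 0 < k < 1.
  by rewrite invr_gt0 invf_lt1 ?b1 ?andbT; lra.
pose s := k^-1 - 1; have s0 : 0 < s by rewrite /s /k invrK subr_gt0.
pose h (z : nat) := expR (- (s * (z%:R - y0%:R))).
pose phi z := Num.min 1 (h z).
have phi_small z : (z <= y0)%N -> phi z = 1.
  move=> zy; apply/min_idPl; rewrite -expR0 ler_expR oppr_ge0.
  by rewrite mulr_ge0_le0 ?(ltW s0)// subr_le0 ler_nat.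
have phi01 z : 0 <= phi z <= 1 by rewrite ge_min lexx le_min ler01 expR_ge0.
pose g (x y : nat) := if x is 0%N then phi y else if y is 0%N then phi x else 1.
have g01 x y : 0 <= g x y <= 1.
  by case: x y => [|x] [|y] //=; rewrite ler01 lexx.
have bg := bounded2_itv01 g01.
have stepg1 x y : step g x y <= 1.
  by apply: step_le => // z; have /andP[] := g01 y z.
exists g; split => //.
- case=> [|x] [|y]; rewrite /g -/g.
  + by rewrite phi_small.
  + have [yy|yy] := leqP y.+1 y0; first by rewrite phi_small.
    have I0 : intensity 0 y.+1 = 0.
      apply/max_idPl; rewrite mulr0 addr0; apply: le_trans hy0.
      by rewrite lerD2r ler_wnM2l ?(ltW a0)// ler_nat ltnW.
    rewrite /step -/(intensity _ _) I0.
    have qphi : quadratic_growth (fun=> phi y.+1 : R).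
      by apply: (@bounded_quadratic_growth _ _ `|phi y.+1|).
    have qid : quadratic_growth (fun z => z%:R : R).
      apply: (@linear_quadratic_growth _ _ 1) => z.
      by rewrite mul1r ger0_norm// lerDr.
    (* At rate 0 the mean of [z] vanishes, so it suffices to dominate [g y.+1 z] by [phi y.+1 + z]:
       this is an equality at [z = 0], and for [z >= 1] the right side is at least 1. *)
    have -> : phi y.+1 = poisson_mean 0 (fun z => phi y.+1 + z%:R).
      by rewrite poisson_meanD// poisson_mean_cst poisson_mean_id// addr0.
    apply: le_poisson_mean => //; first exact: bounded2_growth.
      exact: quadratic_growthD.
    case=> [|z] /=; first by rewrite addr0.
    have /andP[? _] := phi01 y.+1.
    by rewrite -natr1; have : 0 <= z%:R :> R by []; lra.
  + rewrite /phi le_min stepg1/=.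
    apply: (le_trans (@step_le_expR g k s y0%:R x.+1 0 bg k01 erefl _)).
      by move=> z; rewrite /= ge_min lexx orbT.
    by rewrite mulr0 add0r mulrA /k mulVf ?mul1r// gt_eqF//; lra.
  + exact: stepg1.
- rewrite {2}/g phi_small//; apply: (@step00_lt1 _ y0.+1) => //=.
  rewrite gt_min expR_lt1 oppr_lt0 mulr_gt0 ?orbT//.
  by rewrite subr_gt0 ltr_nat.
Qed.

Lemma exists_contraction_factor (del M : R) : 0 < del -> 0 < M ->
  exists k, 0 < k < 1 /\ (1 - k) * M <= del.
Proof.
move=> d0 M0; exists (M / (del + M)).
have dM : 0 < del + M by rewrite addr_gt0.
rewrite divr_gt0//= ltr_pdivrMr// mul1r ltrDr d0; split => //.
have -> : 1 - M / (del + M) = del / (del + M) by field; rewrite gt_eqF.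
by rewrite mulrAC ler_pdivrMr//; nra.
Qed.

Lemma region_T_superharmonic : region_T (a, b) ->
  exists g, [/\ bounded2 g, forall x y, step g x y <= g x y &
    step g 0 0 < g 0%N 0%N].
Proof.
rewrite /region_T/= => bT.
have [ab1|ab1] := ltrP 1 (a + b).
  (* The slope [(a - 1 - b) / 2] used below is the midpoint of the interval from [-b] to [a - 1].
     For it both [a - (r + 1)] and [b + r] equal [del], which absorbs the loss due to [k < 1] on the
     whole quadrant. *)
  pose del := (a + b - 1) / 2.
  have d0 : 0 < del by rewrite /del; lra.
  have M0 : 0 < `|a| + `|b|.
    by have := ler_norm a; have := ler_norm b; lra.
  have [k [k01 kM]] := exists_contraction_factor d0 M0.
  apply: (@cone_superharmonic k ((a - 1 - b) / 2)) => // x y _.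
  have /andP[k0 k1] := k01.
  have ha : (1 - k) * a <= del.
    apply: le_trans kM; rewrite ler_wpM2l ?subr_ge0 ?(ltW k1)//.
    by rewrite (le_trans (ler_norm a))// lerDl.
  have hb : (1 - k) * b <= del.
    apply: le_trans kM; rewrite ler_wpM2l ?subr_ge0 ?(ltW k1)//.
    by rewrite (le_trans (ler_norm b))// lerDr.
  have x0 : 0 <= x%:R :> R by [].
  have y0 : 0 <= y%:R :> R by [].
  have : 0 <= (del - (1 - k) * a) * y%:R by rewrite mulr_ge0// subr_ge0.
  have : 0 <= (del - (1 - k) * b) * x%:R by rewrite mulr_ge0// subr_ge0.
  by rewrite /del; nra.
move: bT; rewrite /b_c; case: ifPn => [a0 b1|].
  by apply: axes_superharmonic => //; lra.
rewrite -ltNge => a0; case: ifPn => [a2 b1|]; first by lra.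
rewrite -leNgt => a2 bc.
(* At [a = 2] the bounds [b > -1] and [a + b <= 1] contradict each other. *)
have {}a2 : 2 < a by rewrite lt_neqAle a2 andbT; apply/eqP => a2'; nra.
(* In terms of [x] and [y - a / 2 * x], both nonnegative on the cone, the required inequality has
   the coefficients [k * (a ^+ 2 / 2 + b) - a ^+ 2 / 4] and [k * a - a / 2 - 1]; [del] is the
   smaller of their values at [k = 1]. *)
pose del := Num.min (a / 2 - 1) (a ^+ 2 / 4 + b).
have d0 : 0 < del by rewrite lt_min; apply/andP; split; lra.
have M0 : 0 < a + (a ^+ 2 / 2 + b).
  by have := sqr_ge0 a; nra.
have [k [/andP[k0 k1] kM]] := exists_contraction_factor d0 M0.
apply: (@cone_superharmonic k (a / 2)); first by rewrite k0.
move=> x y xy.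
have : del <= a / 2 - 1 by rewrite ge_min lexx.
have : del <= a ^+ 2 / 4 + b by rewrite ge_min lexx orbT.
have x0 : 0 <= x%:R :> R by [].
move=> d1 d2.
have ha : (1 - k) * a <= a / 2 - 1.
  apply: le_trans d2; apply: le_trans kM; rewrite ler_wpM2l ?subr_ge0 ?(ltW k1)//.
  by nra.
have hb : (1 - k) * (a ^+ 2 / 2 + b) <= a ^+ 2 / 4 + b.
  apply: le_trans d1; apply: le_trans kM; rewrite ler_wpM2l ?subr_ge0 ?(ltW k1)//.
  by nra.
have p1 : 0 <= (k * a - a / 2 - 1) * (y%:R - a / 2 * x%:R).
  by rewrite mulr_ge0//; lra.
have p2 : 0 <= (k * (a ^+ 2 / 2 + b) - a ^+ 2 / 4) * x%:R.
  by rewrite mulr_ge0//; lra.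
by rewrite -subr_ge0; move: (addr_ge0 p1 p2); congr (0 <= _); field.
Qed.

End SuperharmonicFunctions.

(** * The noiseless dynamics *)

Section Skeleton.
Context {R : realType} (a b : R).
Implicit Types (x y : R) (v w : R * R).

Definition skeleton v : R * R := (v.2, Num.max 0 (a * v.2 + b * v.1)).

Lemma skeleton_ge0 n v : 0 <= v.1 -> 0 <= v.2 ->
  0 <= (iter n skeleton v).1 /\ 0 <= (iter n skeleton v).2.
Proof.
by move=> v1 v2; elim: n => //= n [_ h]; split; rewrite ?le_max ?lexx.
Qed.

Lemma exists_expr_le (k e : R) : 0 <= k < 1 -> 0 < e -> exists j, k ^+ j <= e.
Proof.
move=> /andP[k0 k1] e0.
have : k ^+ n @[n --> \oo] --> (0 : R) by apply: cvg_expr; rewrite ger0_norm.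
move=> /cvgrPdist_le /(_ e e0)[j _ /(_ j (leqnn j))].
by rewrite sub0r normrN ger0_norm ?exprn_ge0// => h; exists j.
Qed.

Definition skeleton_contracts := exists N, forall v, 0 <= v.1 -> 0 <= v.2 ->
  (iter N skeleton v).1 + (iter N skeleton v).2 <= (v.1 + v.2) / 2.

(** If both entries are at most [M], the next value is at most [k * M]. Two steps renew both
    entries, so the maximum shrinks by the factor [k] every two steps. *)
Lemma small_coef_contracts : Num.max 0 a + Num.max 0 b < 1 -> skeleton_contracts.
Proof.
set k := _ + _ => k1.
have a0 : 0 <= Num.max 0 a by rewrite le_max lexx.
have b0 : 0 <= Num.max 0 b by rewrite le_max lexx.
have aa : a <= Num.max 0 a by rewrite le_max lexx orbT.
have bb : b <= Num.max 0 b by rewrite le_max lexx orbT.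
have k0 : 0 <= k by rewrite addr_ge0.
have step1 v M : 0 <= v.1 -> 0 <= v.2 -> v.1 <= M -> v.2 <= M ->
    (skeleton v).2 <= k * M.
  move=> v1 v2 vM1 vM2; rewrite /= ge_max; apply/andP; split.
    by rewrite mulr_ge0// (le_trans v1).
  by rewrite mulrDl lerD// (le_trans (ler_wpM2r _ aa), le_trans (ler_wpM2r _ bb))//
    ler_wpM2l.
have bound j v M : 0 <= v.1 -> 0 <= v.2 -> v.1 <= M -> v.2 <= M ->
    (iter j.*2 skeleton v).1 <= k ^+ j * M /\ (iter j.*2 skeleton v).2 <= k ^+ j * M.
  move=> v1 v2 vM1 vM2; elim: j => [|j [IH1 IH2]]; first by rewrite !mul1r.
  have [w1 w2] := skeleton_ge0 j.*2 v1 v2; rewrite doubleS !iterS.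
  set w := iter _ _ _ in IH1 IH2 w1 w2 *.
  have h1 := step1 w _ w1 w2 IH1 IH2.
  have [w3 w4] := skeleton_ge0 1 w1 w2.
  have M0 : 0 <= k ^+ j * M by apply: le_trans IH1.
  have h2 : (skeleton w).2 <= k ^+ j * M.
    by apply: (le_trans h1); rewrite ler_piMl// ltW.
  by rewrite exprS -mulrA; split => //; apply: step1.
have k01 : 0 <= k < 1 by rewrite k0.
have [|j kj] := @exists_expr_le k (1/4) k01; first by lra.
exists j.*2 => v v1 v2.
have M1 : v.1 <= v.1 + v.2 by rewrite lerDl.
have M2 : v.2 <= v.1 + v.2 by rewrite lerDr.
have [h1 h2] := bound j v _ v1 v2 M1 M2.
have : k ^+ j * (v.1 + v.2) <= 1/4 * (v.1 + v.2) by rewrite ler_wpM2r// addr_ge0.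
by lra.
Qed.

(* The ratio of consecutive values decreases by at least [c] at each step until
   it falls below [k]. *)
Lemma ratio_contracts (k c : R) : 1 <= a -> b <= 0 -> 0 < k < 1 -> 0 < c ->
    (forall r, k <= r <= a -> c * r <= r ^+ 2 - a * r - b) ->
  skeleton_contracts.
Proof.
move=> a1 b0 /andP[k0 k1] c0 hr.
pose rho n := Num.max k (a - n%:R * c).
have rhok n : k <= rho n by rewrite le_max lexx.
have rho0 n : 0 < rho n by apply: lt_le_trans (rhok n).
have rhoa n : rho n <= a.
  rewrite ge_max gerBl mulr_ge0 ?(ltW c0)// andbT; lra.
have rhoS n : rho n - c <= rho n.+1.
  have h : a - n.+1%:R * c <= rho n.+1 by rewrite le_max lexx orbT.
  rewrite lerBlDr ge_max; apply/andP; split; first by have := rhok n.+1; lra.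
  by rewrite -natr1 mulrDl in h; lra.
(* As [b <= 0], a ratio at most [rho] is followed by one at most [a + b / rho], which [hr] bounds by
   [rho - c]. Products are used in place of quotients because the values may be zero. *)
have ratio n v : 0 <= v.1 -> 0 <= v.2 ->
    (iter n.+1 skeleton v).2 <= rho n * (iter n.+1 skeleton v).1.
  move=> v1 v2; elim: n => [|n +].
    rewrite /= ge_max; apply/andP; split; first by rewrite mulr_ge0// ltW.
    apply: (@le_trans _ _ (a * v.2)); first by rewrite gerDl mulr_le0_ge0.
    by rewrite ler_wpM2r// le_max mul0r subr0 lexx orbT.
  have [+ +] := skeleton_ge0 n.+1 v1 v2.
  rewrite (iterS n.+1); move: (iter n.+1 skeleton v) => w w1 w2 /= IH.
  rewrite ge_max; apply/andP; split; first by rewrite mulr_ge0// ltW.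
  rewrite -(ler_pM2l (rho0 n)).
  have := hr (rho n); rewrite rhok rhoa => /(_ isT) h.
  have e1 : b * (rho n * w.1) <= b * w.2 by rewrite ler_wnM2l.
  have e2 : 0 <= (rho n ^+ 2 - a * rho n - b - c * rho n) * w.2.
    by rewrite mulr_ge0// subr_ge0.
  have e3 : 0 <= (rho n.+1 - (rho n - c)) * (rho n * w.2).
    by rewrite mulr_ge0// ?subr_ge0// mulr_ge0// ltW.
  by nra.
have [n0 hn0] : exists n0 : nat, forall n, (n0 <= n)%N -> rho n <= k.
  exists (Num.truncn (a / c)).+1 => n nn0; rewrite ge_max lexx/=.
  have h1 := truncnS_gt (a / c); rewrite ltr_pdivrMr// in h1.
  have h2 : (Num.truncn (a / c)).+1%:R * c <= n%:R * c.
    by rewrite ler_wpM2r ?(ltW c0)// ler_nat.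
  by lra.
have grow n v : 0 <= v.1 -> 0 <= v.2 -> (iter n skeleton v).2 <= a ^+ n * v.2.
  move=> v1 v2; elim: n => [|n IH]; first by rewrite mul1r.
  have [w1 w2] := skeleton_ge0 n.+1 v1 v2.
  apply: (le_trans (ratio n v v1 v2)).
  apply: (@le_trans _ _ (a * (iter n.+1 skeleton v).1)); first by rewrite ler_wpM2r.
  by rewrite exprS -mulrA ler_wpM2l//; lra.
have decay j v : 0 <= v.1 -> 0 <= v.2 ->
    (iter (n0 + j) skeleton v).2 <= k ^+ j * (a ^+ n0 * v.2).
  move=> v1 v2; elim: j => [|j IH]; first by rewrite addn0 mul1r grow.
  have [w1 w2] := skeleton_ge0 (n0 + j).+1 v1 v2.
  rewrite addnS; apply: (le_trans (ratio (n0 + j)%N v v1 v2)).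
  apply: (@le_trans _ _ (k * (iter (n0 + j).+1 skeleton v).1)).
    by rewrite ler_wpM2r// hn0// leq_addr.
  by rewrite exprS -mulrA ler_wpM2l// ltW.
have k01 : 0 <= k < 1 by rewrite ltW.
have an : 0 < a ^+ n0 by rewrite exprn_gt0//; lra.
(* The [j] steps of decay by [k] must offset the growth [a ^+ n0] of the first phase and still leave
   a factor 1/4 for each of the two entries. *)
have [|j kj] := @exists_expr_le k ((4 * a ^+ n0)^-1) k01.
  by rewrite invr_gt0 mulr_gt0.
have kja : k ^+ j * a ^+ n0 <= 1/4.
  by rewrite -ler_pdivlMr// (le_trans kj)// invfM; lra.
exists (n0 + j).+1 => v v1 v2.
have d1 := decay j v v1 v2; have d2 := decay j.+1 v v1 v2.
have [w1 w2] := skeleton_ge0 (n0 + j)%N v1 v2.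
have -> : (iter (n0 + j).+1 skeleton v).1 = (iter (n0 + j) skeleton v).2 by [].
rewrite addnS in d2.
have kj0 : 0 <= k ^+ j * a ^+ n0 
  by apply: mulr_ge0; [exact/exprn_ge0/ltW|exact: ltW].
have q1 : k ^+ j * (a ^+ n0 * v.2) <= 1/4 * v.2 by rewrite mulrA ler_wpM2r.
have q2 : k ^+ j.+1 * (a ^+ n0 * v.2) <= 1/4 * v.2.
  rewrite exprS -mulrA (le_trans _ q1)// ler_piMl ?(ltW k1)//.
  by rewrite mulrA mulr_ge0.
by lra.
Qed.

Lemma region_R_contracts : region_R (a, b) -> skeleton_contracts.
Proof.
rewrite /region_R/= /b_c; case: ifPn => [a0 b1|].
  apply: small_coef_contracts; rewrite (max_idPl a0) add0r gt_max b1 andbT; lra.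
rewrite -ltNge => a0; case: ifPn => [a2 bc|].
  have [a1|a1] := ltrP a 1.
    by apply: small_coef_contracts; rewrite (max_idPr (ltW a0));
      case: (leP 0 b) => _; lra.
  (* In [r ^+ 2 - a * r - b = (1 - r) ^+ 2 + (2 - a) * (r - 1) + (1 - a - b)], the factor [k] is
     close enough to 1 for the middle term to cost at most half of the last one when [r >= k]. *)
  have [k [/andP[k0 k1] kM]] : exists k, 0 < k < 1 /\ (1 - k) * (2 - a) <= (1 - a - b) / 2.
    by apply: exists_contraction_factor; lra.
  apply: (@ratio_contracts k ((1 - a - b) / 2 / a)) => //; rewrite ?k0//.
  - by lra.
  - by rewrite !divr_gt0//; lra.
  - move=> r /andP[kr ra].
    have : (1 - a - b) / 2 / a * r <= (1 - a - b) / 2.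
      by rewrite mulrAC ler_pdivrMr// ler_wpM2l//; lra.
    have : 0 <= (r - k) * (2 - a) by rewrite mulr_ge0; lra.
    by have := sqr_ge0 (1 - r); nra.
rewrite -leNgt => a2 bc.
(* [D] is the minimum of [r ^+ 2 - a * r - b], reached at [r = a / 2]; it is positive exactly when
   this polynomial has no real root. *)
pose D := - b - a ^+ 2 / 4; have D0 : 0 < D by rewrite /D; lra.
apply: (@ratio_contracts (1/2) (D / a)) => //; try lra.
- by have := sqr_ge0 a; lra.
- by rewrite divr_gt0.
- move=> r /andP[kr ra].
  have : D / a * r <= D.
    by rewrite mulrAC ler_pdivrMr// ler_wpM2l//; lra.
  by have := sqr_ge0 (r - a / 2); rewrite /D; nra.
Qed.

End Skeleton.

(** * A Lyapunov function for the noisy chain *)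

Section Lyapunov.
Context {R : realType} (a b lambda : R) (lambda_gt0 : 0 < lambda).
Local Notation step := (step a b lambda).
Local Notation intensity := (intensity a b lambda).
Local Notation skeleton := (skeleton a b).
Implicit Types v w : R * R.

Let dist v w : R := `|v.1 - w.1| + `|v.2 - w.2|.

Let lip : R := 1 + `|a| + `|b|.

Let lip_ge0 : 0 <= lip.
Proof. by rewrite !addr_ge0. Qed.

Lemma max0_lipschitz (p q : R) : `|Num.max 0 p - Num.max 0 q| <= `|p - q|.
Proof.
have h (x y : R) : Num.max 0 x - Num.max 0 y <= `|x - y|.
  rewrite lerBlDr ge_max addr_ge0 ?le_max ?lexx//= -lerBlDr.
  apply: le_trans (ler_norm _); rewrite lerD2l lerN2 le_max lexx orbT//.
by rewrite ler_norml h andbT lerNl opprB distrC h.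
Qed.

Let skeleton_lipschitz v w : dist (skeleton v) (skeleton w) <= lip * dist v w.
Proof.
rewrite /dist /lip /=.
have h1 := max0_lipschitz (a * v.2 + b * v.1) (a * w.2 + b * w.1).
have h2 : `|a * v.2 + b * v.1 - (a * w.2 + b * w.1)| <=
    `|a| * `|v.2 - w.2| + `|b| * `|v.1 - w.1|.
  rewrite -!normrM; apply: le_trans (ler_normD _ _).
  by rewrite le_eqVlt; apply/orP; left; apply/eqP; congr `|_|; ring.
have p1 : 0 <= `|a| * `|v.1 - w.1| by rewrite mulr_ge0.
have p2 : 0 <= `|b| * `|v.2 - w.2| by rewrite mulr_ge0.
have p3 := normr_ge0 (v.1 - w.1).
by nra.
Qed.

Let iter_skeleton_lipschitz n v w :
  dist (iter n skeleton v) (iter n skeleton w) <= lip ^+ n * dist v w.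
Proof.
elim: n => [|n IH]; first by rewrite mul1r.
by rewrite !iterS exprS -mulrA (le_trans (skeleton_lipschitz _ _))// ler_wpM2l.
Qed.

Let skeleton_sum N v : R :=
  \sum_(k < N) ((iter k skeleton v).1 + (iter k skeleton v).2).

Let skeleton_sum_lipschitz N v w :
  `|skeleton_sum N v - skeleton_sum N w| <= (\sum_(k < N) lip ^+ k) * dist v w.
Proof.
rewrite /skeleton_sum -sumrB mulr_suml (le_trans (ler_norm_sum _ _ _))//.
apply: ler_sum => k _; apply: le_trans (iter_skeleton_lipschitz k v w).
by rewrite opprD addrACA; exact: ler_normD.
Qed.

(** Moving along the orbit drops its first term and adds the [N]-th iterate. When that iterate is at
    most half of the first term, the sum falls by at least half of [v.1 + v.2]. *)
Let skeleton_sumS N v : skeleton_sum N (skeleton v) =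
  skeleton_sum N v - (v.1 + v.2) +
  ((iter N skeleton v).1 + (iter N skeleton v).2).
Proof.
pose F k := (iter k skeleton v).1 + (iter k skeleton v).2.
rewrite /skeleton_sum (eq_bigr (fun k : 'I_N => F k.+1)); last first.
  by move=> k _; rewrite -iterSr.
apply: (addrI (F 0%N)).
have -> : F 0%N + \sum_(k < N) F k.+1 = \sum_(k < N.+1) F k.
  by rewrite big_ord_recl.
by rewrite big_ord_recr /F/=; ring.
Qed.

Let skeleton0 n : iter n skeleton (0, 0) = (0, 0).
Proof. by elim: n => //= n ->; congr pair; rewrite /= !mulr0 addr0 maxxx. Qed.

Let skeleton_sum0 N : skeleton_sum N (0, 0) = 0.
Proof. by rewrite /skeleton_sum big1// => k _; rewrite skeleton0 addr0. Qed.

Let dist_skeleton_intensity x y (z : nat) :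
  dist (y%:R, z%:R) (skeleton (x%:R, y%:R)) <= `|z%:R - intensity x y| + lambda.
Proof.
rewrite /dist /= subrr normr0 add0r.
set t := Num.max _ _.
have : `|intensity x y - t| <= lambda.
  apply: le_trans (max0_lipschitz _ _) _.
  by rewrite addrAC subrr add0r ger0_norm// ltW.
have -> : z%:R - t = (z%:R - intensity x y) + (intensity x y - t) by ring.
by move=> h; rewrite (le_trans (ler_normD _ _))// lerD2l.
Qed.

Lemma intensity_le x y :
  intensity x y <= lambda + (`|a| + `|b|) * (x%:R + y%:R).
Proof.
have x0 : 0 <= x%:R :> R by []. have y0 : 0 <= y%:R :> R by [].
rewrite ge_max addr_ge0 ?mulr_ge0 ?addr_ge0 ?(ltW lambda_gt0)//=.
have : a * y%:R <= `|a| * y%:R by rewrite ler_wpM2r// ler_norm.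
have : b * x%:R <= `|b| * x%:R by rewrite ler_wpM2r// ler_norm.
have p1 : 0 <= `|a| * x%:R by rewrite mulr_ge0.
have p2 : 0 <= `|b| * y%:R by rewrite mulr_ge0.
by nra.
Qed.

Lemma poisson_mean_quadratic (rate c e : R) : 0 <= rate ->
  poisson_mean rate (fun z => c + e * (z%:R - rate) ^+ 2) = c + e * rate.
Proof.
move=> r0.
have qc u : quadratic_growth (fun=> u : R).
  exact: (@bounded_quadratic_growth _ _ `|u|).
have q1 : quadratic_growth (fun z => z%:R : R).
  apply: (@linear_quadratic_growth _ _ 1) => z.
  by rewrite mul1r ger0_norm// lerDr.
have q2 : quadratic_growth (fun z => z%:R ^+ 2 : R).
  by exists 1 => z; rewrite mul1r ger0_norm ?sqr_ge0// lerDr.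
have -> : (fun z : nat => c + e * (z%:R - rate) ^+ 2) =
    (fun z => (c + e * rate ^+ 2) + (e * z%:R ^+ 2 + (- (2 * e * rate)) * z%:R)).
  by apply/funext => z; ring.
rewrite !poisson_meanD ?poisson_meanZ ?poisson_mean_cst ?poisson_mean_sqr
  ?poisson_mean_id//; try exact: quadratic_growthZ; first by ring.
by apply: quadratic_growthD; exact: quadratic_growthZ.
Qed.

(** The arithmetic that concludes the drift estimate: [s] is [x + y], [S] the size of the [N]-th
    iterate, [mu] the intensity. Of the gain [s], half is lost to [S] and a quarter to the noise;
    the last quarter dominates [h * Vx]. *)
Let drift_bound (Vx s S mu l L e M h c : R) : S <= s / 2 ->
  L * e * mu <= L * e * (l + M * s) -> L * M * e * s <= 1/4 * s ->
  h * Vx <= 1/4 * s ->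
  Vx - s + S + L * (l + c) + L * e * mu <=
  (1 - h) * Vx + (L * (l + c) + L * e * l).
Proof. by move=> h1 h2 h3 h4; lra. Qed.

(** [V] is the sum along [N] steps of the noiseless orbit. By the Lipschitz bound, its value at the
    next random state exceeds the noiseless one by at most [Lam] times the deviation of the Poisson
    variable plus [lambda]; what remains is to make the mean deviation small compared with
    [x + y]. *)
Lemma lyapunov_function : skeleton_contracts a b ->
  exists (V : nat -> nat -> R) (H gam K : R),
    [/\ 0 <= gam < 1, forall x y, x%:R + y%:R <= V x y,
        forall x y, V x y <= H * (x%:R + y%:R) &
        forall x y, step V x y <= gam * V x y + K].
Proof.
move=> [N contr].
have N0 : (0 < N)%N.
  by case: N contr => // /(_ (1, 0)) /=; rewrite ler01 lexx => /(_ isT isT); lra.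
pose V (x y : nat) := skeleton_sum N (x%:R, y%:R).
pose Lam := \sum_(k < N) lip ^+ k.
have Lam0 : 0 <= Lam by apply: sumr_ge0 => k _; rewrite exprn_ge0.
pose H := Lam + 1.
have H0 : 0 < H by rewrite /H; lra.
have VH x y : V x y <= Lam * (x%:R + y%:R).
  have h := skeleton_sum_lipschitz N (x%:R, y%:R) (0, 0).
  rewrite skeleton_sum0 subr0 in h.
  apply: (le_trans (ler_norm _)); apply: (le_trans h).
  by rewrite /dist /= !subr0 !ger0_norm.
have V1 x y : x%:R + y%:R <= V x y.
  rewrite /V /skeleton_sum -(prednK N0) big_ord_recl /= lerDl sumr_ge0// => k _.
  have [] := @skeleton_ge0 _ a b (bump 0 k) (x%:R, y%:R) (ler0n _ _) (ler0n _ _).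
  exact: addr_ge0.
pose M := `|a| + `|b|.
have M0 : 0 <= M by rewrite addr_ge0.
(* The variance equals the intensity, which is at most [lambda + M * (x + y)]; with this [e] the
   noise costs at most a quarter of [x + y], plus constants. *)
pose e := (4 * (Lam * M + 1))^-1.
have LM : 0 < Lam * M + 1 by have := mulr_ge0 Lam0 M0; lra.
have e0 : 0 < e by rewrite invr_gt0 mulr_gt0.
have eLM : Lam * M * e <= 1/4.
  by rewrite /e ler_pdivrMr ?mulr_gt0//; lra.
have H1 : 0 < (4 * H)^-1 by rewrite invr_gt0 mulr_gt0.
have H1' : (4 * H)^-1 <= 1/4.
  by rewrite div1r lef_pV2 ?posrE ?mulr_gt0// /H; have := Lam0; lra.
exists V, Lam, (1 - (4 * H)^-1), (Lam * (lambda + (4 * e)^-1) + Lam * e * lambda).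
split => //; first by apply/andP; split; lra.
move=> x y; have I0 := intensity_ge0 a b lambda x y.
set mu := intensity x y in I0.
pose c := skeleton_sum N (skeleton (x%:R, y%:R)) + Lam * (lambda + (4 * e)^-1).
have bound z : V y z <= c + Lam * e * (z%:R - mu) ^+ 2.
  have h1 := skeleton_sum_lipschitz N (y%:R, z%:R) (skeleton (x%:R, y%:R)).
  have h2 := le_trans (ler_norm _) h1.
  have h3 : Lam * dist (y%:R, z%:R) (skeleton (x%:R, y%:R)) <=
      Lam * (`|z%:R - mu| + lambda) by rewrite ler_wpM2l// dist_skeleton_intensity.
  (* Young's inequality trades the absolute deviation for its square, whose mean is known. *)
  have h4 : `|z%:R - mu| <= e * (z%:R - mu) ^+ 2 + (4 * e)^-1.
    rewrite -real_normK ?num_real//; move: (`|z%:R - mu|) => t.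
    have -> : e * t ^+ 2 + (4 * e)^-1 = t + e * (t - (2 * e)^-1) ^+ 2.
      by field; rewrite gt_eqF.
    by rewrite lerDl mulr_ge0 ?sqr_ge0// ltW.
  have h5 : Lam * `|z%:R - mu| <= Lam * (e * (z%:R - mu) ^+ 2 + (4 * e)^-1).
    by rewrite ler_wpM2l.
  by move: h2 h3 h5; rewrite /c /V -/Lam; nra.
have qV : quadratic_growth (V y).
  apply: (@linear_quadratic_growth _ _ (Lam * (1 + y%:R))) => z.
  have x0 : 0 <= z%:R :> R by []. have y0 : 0 <= y%:R :> R by [].
  rewrite ger0_norm; last by apply: le_trans (V1 y z); rewrite addr_ge0.
  apply: (le_trans (VH y z)); rewrite -mulrA ler_wpM2l//.
  by have := mulr_ge0 x0 y0; nra.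
have qb : quadratic_growth (fun z => c + Lam * e * (z%:R - mu) ^+ 2).
  apply: quadratic_growthD.
    exact: (@bounded_quadratic_growth _ _ `|c|).
  apply: quadratic_growthZ; exists (2 + 2 * mu ^+ 2) => z.
  rewrite ger0_norm ?sqr_ge0//.
  have := sqr_ge0 (z%:R + mu); have := sqr_ge0 (z%:R * mu); nra.
have := le_poisson_mean I0 qV qb bound.
rewrite poisson_mean_quadratic// -/(step V x y) => hs.
apply: (le_trans hs); rewrite /c.
have hS := contr (x%:R, y%:R) (ler0n _ _) (ler0n _ _).
have hmu : Lam * e * mu <= Lam * e * (lambda + M * (x%:R + y%:R)).
  by rewrite ler_wpM2l ?intensity_le// mulr_ge0// ltW.
have s0 : 0 <= x%:R + y%:R :> R by rewrite addr_ge0.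
have h6 : Lam * M * e * (x%:R + y%:R) <= 1/4 * (x%:R + y%:R) by rewrite ler_wpM2r.
have h7 : (4 * H)^-1 * V x y <= 1/4 * (x%:R + y%:R).
  rewrite mulrC ler_pdivrMr ?mulr_gt0//; apply: (le_trans (VH x y)).
  by rewrite /H; lra.
rewrite (skeleton_sumS N).
exact: drift_bound hS hmu h6 h7.
Qed.

End Lyapunov.

(** * Contraction of the two-step kernel *)

(* [F1], [W1] and [F2], [W2] are the values at [f] and [V] of two positive
   functionals of mass [m], which are applied in one variable after the other. *)
Lemma positive_functionals_gap (R : realType) (S : Type) (f V : S -> R)
    (m F1 W1 F2 W2 M be : R) : 0 < m ->
    (forall p r q, (forall u, 0 <= p * f u + r * V u + q) ->
      0 <= p * F1 + r * W1 + q * m) ->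
    (forall p r q, (forall u, 0 <= p * f u + r * V u + q) ->
      0 <= p * F2 + r * W2 + q * m) ->
    (forall u u', f u - f u' <= M * (2 + be * V u + be * V u')) ->
  F1 - F2 <= M * (2 * m + be * W1 + be * W2).
Proof.
move=> m0 pos1 pos2 gap.
have h1 u' : 0 <= m * f u' + m * (M * be) * V u' + (- F1 + M * be * W1 + m * (2 * M)).
  have := pos1 (-1) (M * be) (f u' + M * (2 + be * V u')) => h.
  have : 0 <= -1 * F1 + M * be * W1 + (f u' + M * (2 + be * V u')) * m.
    by apply: h => u; have := gap u u'; lra.
  by lra.
have h2 := pos2 _ _ _ h1.
have : 0 <= m * (M * (2 * m + be * W1 + be * W2) - (F1 - F2)) by lra.
by rewrite pmulr_rge0// subr_ge0.
Qed.

(** * Functions of linear growth under the transition operator *)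

Section LinearGrowth.
Context {R : realType} (a b lambda : R) (lambda_gt0 : 0 < lambda).
Local Notation step := (step a b lambda).
Local Notation intensity := (intensity a b lambda).
Implicit Types f g : nat -> nat -> R.

(** A class that contains the bounded functions and [V] and is stable under [step]. *)
Definition linear2 f := exists A : R, forall x y, `|f x y| <= A * (1 + x%:R + y%:R).

Lemma bounded2_linear2 f : bounded2 f -> linear2 f.
Proof.
move=> [A fA]; exists A => x y; apply: (le_trans (fA x y)).
rewrite ler_peMr//; first exact: le_trans (fA x y).
by rewrite -addrA lerDl addr_ge0.
Qed.

Lemma linear2_growth f y : linear2 f -> quadratic_growth (f y).
Proof.
move=> [A fA].
have A0 : 0 <= A by have := le_trans (normr_ge0 _) (fA 0%N 0%N); rewrite !addr0 mulr1.
apply: (@linear_quadratic_growth _ _ (A * (1 + y%:R))) => z.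
apply: (le_trans (fA y z)); rewrite -mulrA ler_wpM2l//.
have y0 : 0 <= y%:R :> R by []. have z0 : 0 <= z%:R :> R by [].
by have := mulr_ge0 y0 z0; lra.
Qed.

Lemma linear2D f g : linear2 f -> linear2 g -> linear2 (fun x y => f x y + g x y).
Proof.
move=> [A fA] [B gB]; exists (A + B) => x y.
by rewrite mulrDl (le_trans (ler_normD _ _))// lerD.
Qed.

Lemma linear2Z c f : linear2 f -> linear2 (fun x y => c * f x y).
Proof.
by move=> [A fA]; exists (`|c| * A) => x y; rewrite normrM -mulrA ler_wpM2l.
Qed.

Lemma linear2_cst c : linear2 (fun _ _ => c).
Proof. exact/bounded2_linear2/bounded2_cst. Qed.

Lemma linear2_combination (p r q : R) f g : linear2 f -> linear2 g ->
  linear2 (fun x y => p * f x y + r * g x y + q).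
Proof.
by move=> lf lg; apply: linear2D (linear2_cst q); apply: linear2D; exact: linear2Z.
Qed.

Lemma step_combination (p r q : R) f g x y : linear2 f -> linear2 g ->
  step (fun x y => p * f x y + r * g x y + q) x y =
  p * step f x y + r * step g x y + q.
Proof.
move=> lf lg; have I0 := intensity_ge0 a b lambda x y.
have qf := linear2_growth y lf; have qg := linear2_growth y lg.
have qc : quadratic_growth (fun=> q : R).
  exact: (@bounded_quadratic_growth _ _ `|q|).
rewrite /step !poisson_meanD ?poisson_meanZ ?poisson_mean_cst//;
  try exact: quadratic_growthZ.
by apply: quadratic_growthD; exact: quadratic_growthZ.
Qed.

Lemma le_step f g x y : linear2 f -> linear2 g -> (forall x y, f x y <= g x y) ->
  step f x y <= step g x y.
Proof.
move=> lf lg fg; apply: le_poisson_mean => //; first exact: intensity_ge0.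
- exact: linear2_growth.
- exact: linear2_growth.
Qed.

Lemma step_cst c x y : step (fun _ _ => c) x y = c.
Proof. exact: poisson_mean_cst. Qed.

Lemma step_ge0 f x y : (forall x y, 0 <= f x y) -> 0 <= step f x y.
Proof. by move=> f0; apply: Rintegral_ge0. Qed.

Lemma linear2_step f : linear2 f -> linear2 (step f).
Proof.
move=> lf; have [A fA] := lf.
have A0 : 0 <= A by have := le_trans (normr_ge0 _) (fA 0%N 0%N); rewrite !addr0 mulr1.
pose n1 (x y : nat) : R := x%:R + y%:R.
have l1 : linear2 n1.
  exists 1 => x y; rewrite mul1r ger0_norm ?addr_ge0//.
  by rewrite -addrA lerDr.
pose M := `|a| + `|b|; have M0 : 0 <= M by rewrite addr_ge0.
have n1E x y : step n1 x y = y%:R + intensity x y.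
  rewrite /step /n1 poisson_meanD ?poisson_mean_cst ?poisson_mean_id//;
    rewrite ?intensity_ge0//.
    exact: (@bounded_quadratic_growth _ _ `|y%:R|).
  apply: (@linear_quadratic_growth _ _ 1) => z.
  by rewrite mul1r ger0_norm// lerDr.
have bnd x y : step (fun x y => A * n1 x y + 0 * n1 x y + A) x y <=
    A * (2 + M + lambda) * (1 + x%:R + y%:R).
  rewrite step_combination// mul0r addr0 n1E.
  have hI := intensity_le a b lambda_gt0 x y; rewrite -/M in hI.
  have x0 : 0 <= x%:R :> R by []. have y0 : 0 <= y%:R :> R by [].
  have s0 := addr_ge0 x0 y0.
  have p : 0 <= lambda * (x%:R + y%:R) by rewrite mulr_ge0// ltW.
  have -> : A * (y%:R + intensity x y) + A = A * (1 + y%:R + intensity x y) by ring.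
  rewrite -mulrA ler_wpM2l//.
  by lra.
exists (A * (2 + M + lambda)) => x y.
have nf c : linear2 (fun x y => c * f x y + 0 * f x y + 0) by exact: linear2_combination.
have up c : `|c| = 1 -> c * step f x y <= A * (2 + M + lambda) * (1 + x%:R + y%:R).
  move=> c1; apply: le_trans (bnd x y).
  have -> : c * step f x y = step (fun x y => c * f x y + 0 * f x y + 0) x y.
    by rewrite step_combination// mul0r !addr0.
  apply: le_step => //; first exact: linear2_combination.
  move=> u v; rewrite !mul0r !addr0; apply: (le_trans (ler_norm _)).
  rewrite normrM c1 mul1r; apply: (le_trans (fA u v)).
  by rewrite /n1; lra.
have := up 1; have := up (-1); rewrite normrN normr1 => /(_ erefl) h1 /(_ erefl) h2.
by rewrite ler_norml; apply/andP; split; lra.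
Qed.

Lemma linear2_iter_step n f : linear2 f -> linear2 (iter n step f).
Proof. by move=> lf; elim: n => //= n IH; exact: linear2_step. Qed.

(* Two zero steps in a row bring the chain to (0, 0), from anywhere. *)
Lemma step2_ge_zero f x y : linear2 f -> (forall x y, 0 <= f x y) ->
  expR (- (intensity x y + intensity y 0)) * f 0%N 0%N <= step (step f) x y.
Proof.
move=> lf f0.
have m0 r : poisson_mass r 0 = expR (- r) :> R.
  by rewrite /poisson_mass expr0 fact0 invr1 !mul1r.
have h u v g : linear2 g -> (forall x y, 0 <= g x y) ->
    expR (- intensity u v) * g v 0%N <= step g u v.
  move=> lg g0; rewrite -m0; apply: poisson_mean_ge_mass => //.
    exact: intensity_ge0.
  exact: linear2_growth.
have sf0 u v : 0 <= step f u v by exact: step_ge0.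
apply: le_trans (h x y _ (linear2_step lf) sf0).
by rewrite opprD expRD -mulrA ler_wpM2l ?expR_ge0// h.
Qed.

End LinearGrowth.

(** By the choice of [level], half of the gain [(1 - gam) * (be * (v + v'))] covers [4 * be * K] and
    [2 * tau]; another quarter covers [tau * (be * (v + v'))]. *)
Lemma far_contraction (R : realType) (gam K be tau level v v' w w' : R) :
    0 <= v -> 0 <= v' -> gam < 1 -> 0 <= K -> 0 < be -> tau <= be ->
    tau <= (1 - gam) / 4 -> (1 - gam) * level = 8 * K + 4 ->
    level <= v + v' -> w <= gam * v + 2 * K -> w' <= gam * v' + 2 * K ->
  2 * 1 + be * w + be * w' <= (1 - tau) * (2 + be * v + be * v').
Proof.
move=> v0 v0' g1 K0 be0 tau1 tau2 gl far d1 d2.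
have h1 : be * w <= be * (gam * v + 2 * K) by rewrite ler_wpM2l// ltW.
have h2 : be * w' <= be * (gam * v' + 2 * K) by rewrite ler_wpM2l// ltW.
have e2 : be * ((1 - gam) * level) <= be * ((1 - gam) * (v + v')).
  by rewrite ler_wpM2l ?(ltW be0)// ler_wpM2l//; lra.
rewrite gl in e2.
have e3 : tau * (be * (v + v')) <= (1 - gam) / 4 * (be * (v + v')).
  by rewrite ler_wpM2r// mulr_ge0 ?addr_ge0// ltW.
have e4 : 0 <= be * K by rewrite mulr_ge0// ltW.
by lra.
Qed.

(** The gain is now the removed mass, [2 * eta]: it covers [4 * be * K <= eta] and
    [2 * tau <= eta / 2], while the drift still covers [tau * (be * (v + v'))]. *)
Lemma near_contraction (R : realType) (gam K be tau eta v v' w w' : R) :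
    0 <= v -> 0 <= v' -> gam < 1 -> 0 <= K -> 0 < be -> tau <= eta / 4 ->
    tau <= (1 - gam) / 4 -> be * (4 * (K + 1)) = eta ->
    w <= gam * v + 2 * K -> w' <= gam * v' + 2 * K ->
  2 * (1 - eta) + be * w + be * w' <= (1 - tau) * (2 + be * v + be * v').
Proof.
move=> v0 v0' g1 K0 be0 tau3 tau2 beK d1 d2.
have h1 : be * w <= be * (gam * v + 2 * K) by rewrite ler_wpM2l// ltW.
have h2 : be * w' <= be * (gam * v' + 2 * K) by rewrite ler_wpM2l// ltW.
have e0 : 0 <= be * (v + v') by rewrite mulr_ge0 ?addr_ge0// ltW.
have e3 : tau * (be * (v + v')) <= (1 - gam) / 4 * (be * (v + v')).
  by rewrite ler_wpM2r.
have e5 : 0 <= be * K by rewrite mulr_ge0// ltW.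
have e4 : 0 <= (1 - gam) * (be * (v + v')) by rewrite mulr_ge0//; lra.
by lra.
Qed.

(** What remains of the two-step kernel after removal of its atom of mass [eta] at (0, 0) is a
    positive functional of mass [1 - eta]. *)
Lemma residual_positive (R : realType) (p r q eta F F0 W W0 : R) :
    eta * (p * F0 + r * W0 + q) <= p * F + r * W + q ->
  0 <= p * (F - eta * F0) + r * (W - eta * W0) + q * (1 - eta).
Proof. lra. Qed.

(** The removed atom is common to both kernels, so it cancels in the difference; it does not affect
    the weights because [V] vanishes at (0, 0). *)
Lemma cancel_atom (R : realType) (F F' W W' f0 w0 eta M m be : R) :
    F - eta * f0 - (F' - eta * f0) <=
      M * (m + be * (W - eta * w0) + be * (W' - eta * w0)) ->
  w0 = 0 -> F - F' <= M * (m + be * W + be * W').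
Proof. by move=> + w0E; rewrite w0E; lra. Qed.

Section Harris.
Context {R : realType} (a b lambda : R) (lambda_gt0 : 0 < lambda).
Local Notation step := (step a b lambda).
Local Notation step2 := (fun f => step (step f)).
Local Notation intensity := (intensity a b lambda).
Implicit Types f g : nat -> nat -> R.

Context (V : nat -> nat -> R) (H gam K : R).
Hypothesis gam01 : 0 <= gam < 1.
Hypothesis V_ge : forall x y, x%:R + y%:R <= V x y.
Hypothesis V_le : forall x y, V x y <= H * (x%:R + y%:R).
Hypothesis drift : forall x y, step V x y <= gam * V x y + K.

Lemma lyapunov_ge0 x y : 0 <= V x y.
Proof. by apply: le_trans (V_ge x y); rewrite addr_ge0. Qed.

Lemma lyapunov00 : V 0%N 0%N = 0.
Proof.
apply/eqP; rewrite eq_le lyapunov_ge0 andbT.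
by apply: le_trans (V_le 0 0) _; rewrite addr0 mulr0.
Qed.

Lemma drift_cst_ge0 : 0 <= K.
Proof.
have := drift 0%N 0%N; rewrite lyapunov00 mulr0 add0r; apply: le_trans.
by apply: step_ge0; exact: lyapunov_ge0.
Qed.

Lemma linear2_lyapunov : linear2 V.
Proof.
exists `|H| => x y; rewrite ger0_norm ?lyapunov_ge0//.
apply: (le_trans (V_le x y)).
have s0 : 0 <= x%:R + y%:R :> R by rewrite addr_ge0.
have h : H * (x%:R + y%:R) <= `|H| * (x%:R + y%:R) by rewrite ler_wpM2r// ler_norm.
by apply: (le_trans h); rewrite ler_wpM2l// -addrA lerDr.
Qed.
Let lV := linear2_lyapunov.

Lemma step2_combination (p r q : R) f x y : linear2 f ->
  step2 (fun x y => p * f x y + r * V x y + q) x y =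
  p * step2 f x y + r * step2 V x y + q.
Proof.
move=> lf; rewrite -step_combination//; try exact: linear2_step.
congr (step _ x y); apply/funext => u; apply/funext => v.
exact: step_combination.
Qed.

Lemma step2_drift x y : step2 V x y <= gam * V x y + 2 * K.
Proof.
have /andP[g0 g1] := gam01; have K0 := drift_cst_ge0.
apply: (@le_trans _ _ (step (fun x y => gam * V x y + 0 * V x y + K) x y)).
  apply: le_step => //; first exact: linear2_step.
    exact: linear2_combination.
  by move=> u v; rewrite mul0r addr0; exact: drift.
rewrite step_combination// mul0r addr0.
have h1 : gam * step V x y <= gam * (gam * V x y + K) by rewrite ler_wpM2l.
have h2 : gam * (gam * V x y) <= gam * V x y.
  by rewrite ler_piMl ?(ltW g1)// mulr_ge0// lyapunov_ge0.
have h3 : gam * K <= K by rewrite ler_piMl// ltW.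
by lra.
Qed.

(** [M] bounds the oscillation of [f] relative to the weight. Where [V] is large the weight
    decreases in mean; near the origin the two kernels overlap. The parameter [be] is small enough
    for the overlap to outweigh the constant [K] of the drift. *)
Lemma step2_contraction : exists be al : R, [/\ 0 < be, 0 <= al < 1 &
  forall f (M : R), linear2 f -> 0 <= M ->
    (forall x y x' y', f x y - f x' y' <= M * (2 + be * V x y + be * V x' y')) ->
  forall x y x' y', step2 f x y - step2 f x' y' <=
    al * M * (2 + be * V x y + be * V x' y')].
Proof.
have /andP[g0 g1] := gam01; have K0 := drift_cst_ge0.
pose gap := 1 - gam; have gap0 : 0 < gap by rewrite subr_gt0.
pose level := (8 * K + 4) / gap.
pose A := `|a| + `|b|; have A0 : 0 <= A by rewrite addr_ge0.
have level0 : 0 < level by rewrite divr_gt0//; lra.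
have gl : gap * level = 8 * K + 4 by rewrite /level mulrC divfK// gt_eqF.
(* A lower bound for the probability of two zeros in a row from a state with [V <= level], where
   both intensities are at most [lambda + A * level]. *)
pose eta := expR (- (2 * (lambda + A * level))).
have eta0 : 0 < eta by rewrite expR_gt0.
have eta1 : eta < 1.
  by rewrite expR_lt1 oppr_lt0 mulr_gt0// ltr_wpDr// mulr_ge0// ltW.
pose be := eta / (4 * (K + 1)).
have K1 : 0 < 4 * (K + 1) by lra.
have be0 : 0 < be by rewrite divr_gt0.
have beK : be * (4 * (K + 1)) = eta by rewrite /be divfK// gt_eqF.
pose tau := Num.min be (Num.min (gap / 4) (eta / 4)).
have tau0 : 0 < tau by rewrite !lt_min be0 !divr_gt0.
have tau1 : tau <= be by rewrite ge_min lexx.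
have tau2 : tau <= gap / 4 by rewrite !ge_min lexx !orbT.
have tau3 : tau <= eta / 4 by rewrite !ge_min lexx !orbT.
exists be, (1 - tau); split => //; first by apply/andP; split; lra.
move=> f M lf M0 hf x y x' y'.
pose F (u : nat * nat) := f u.1 u.2; pose W (u : nat * nat) := V u.1 u.2.
have hF u u' : F u - F u' <= M * (2 + be * W u + be * W u') by exact: hf.
have V0 := lyapunov_ge0 x y; have V0' := lyapunov_ge0 x' y'.
have d1 := step2_drift x y; have d2 := step2_drift x' y'.
have pos p r q : (forall u, 0 <= p * F u + r * W u + q) ->
    forall i j, 0 <= p * f i j + r * V i j + q.
  by move=> h i j; exact: (h (i, j)).
have lc p r q : linear2 (fun i j => p * f i j + r * V i j + q).
  exact: linear2_combination.
(* Far from the origin the drift of [V] suffices; otherwise the common atom of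
   mass [eta] at (0, 0) is removed from both kernels. *)
have [far|near] := lerP level (V x y + V x' y').
  have posQ i j p r q : (forall u, 0 <= p * F u + r * W u + q) ->
      0 <= p * step2 f i j + r * step2 V i j + q * 1.
    move=> /pos h; rewrite mulr1 -step2_combination//.
    by apply: step_ge0 => *; exact: step_ge0.
  apply: (le_trans (positive_functionals_gap ltr01 (posQ x y) (posQ x' y') hF)).
  rewrite [leRHS]mulrAC [leRHS]mulrC ler_wpM2l//.
  exact: (far_contraction V0 V0' g1 K0 be0 tau1 tau2 gl far d1 d2).
have small i j : V i j <= level ->
    eta <= expR (- (intensity i j + intensity j 0)).
  move=> Vl; have := le_trans (V_ge i j) Vl => ijl.
  have i0 : 0 <= i%:R :> R by []. have j0 : 0 <= j%:R :> R by [].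
  have h1 := intensity_le a b lambda_gt0 i j.
  have h2 := intensity_le a b lambda_gt0 j 0.
  rewrite -/A in h1 h2.
  have h3 : intensity i j <= lambda + A * level.
    by apply: (le_trans h1); rewrite lerD2l ler_wpM2l.
  have h4 : intensity j 0 <= lambda + A * level.
    apply: (le_trans h2); rewrite lerD2l ler_wpM2l// addr0.
    by apply: le_trans ijl; rewrite lerDr.
  by rewrite ler_expR lerN2 mulr_natl mulr2n lerD.
have posR i j : V i j <= level -> forall p r q,
    (forall u, 0 <= p * F u + r * W u + q) ->
    0 <= p * (step2 f i j - eta * f 0%N 0%N) +
         r * (step2 V i j - eta * V 0%N 0%N) + q * (1 - eta).
  move=> Vl p r q /pos h.
  have h1 := step2_ge_zero a b lambda_gt0 i j (lc p r q) h.
  have := step2_combination p r q i j lf => /= h2; rewrite h2 in h1.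
  have h3 : eta * (p * f 0%N 0%N + r * V 0%N 0%N + q) <=
    expR (- (intensity i j + intensity j 0)) *
    (p * f 0%N 0%N + r * V 0%N 0%N + q) by apply: ler_wpM2r; [exact: h|exact: small].
  exact: residual_positive (le_trans h3 h1).
have Vl : V x y <= level by apply: le_trans (ltW near); rewrite lerDl.
have Vl' : V x' y' <= level by apply: le_trans (ltW near); rewrite lerDr.
have eta1' : 0 < 1 - eta by rewrite subr_gt0.
have h := positive_functionals_gap eta1' (posR x y Vl) (posR x' y' Vl') hF.
apply: (le_trans (cancel_atom h lyapunov00)); rewrite [leRHS]mulrAC [leRHS]mulrC ler_wpM2l//.
exact: (near_contraction V0 V0' g1 K0 be0 tau3 tau2 beK d1 d2).
Qed.

End Harris.

(** * Convergence in law *)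

Section Sequences.
Context {R : realType}.
Implicit Type u : nat -> R.

Lemma geometric_increments_cvg u (C al : R) : 0 <= al < 1 ->
  (forall m, `|u m.+1 - u m| <= C * al ^+ m) -> cvgn u.
Proof.
move=> /andP[a0 a1] h.
have al1 : `|al| < 1 by rewrite ger0_norm.
have : cvgn (series (telescope u)).
  apply: normed_cvg; apply: (series_le_cvg _ _ h) => //.
    by move=> m; apply: le_trans (h m).
  exact: is_cvg_geometric_series.
move=> cu; have -> : u = (fun n => u 0%N + series (telescope u) n).
  by apply/funext => n; rewrite telescopeK/= addrC subrK.
exact: is_cvgD (is_cvg_cst _) cu.
Qed.

Lemma geometric_dist_cvg u v (C al l : R) : 0 <= al < 1 ->
  (forall m, `|v m - u m| <= C * al ^+ m) ->
  u @ \oo --> l -> v @ \oo --> l.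
Proof.
move=> /andP[a0 a1] h ul.
have -> : v = (fun m => u m + (v m - u m)) by apply/funext => m; rewrite addrC subrK.
rewrite -[l]addr0; apply: cvgD => //; apply/norm_cvg0P.
apply: (@squeeze_cvgr _ _ _ _ (fun=> 0) (fun m => C * al ^+ m)).
- by apply: nearW => m; rewrite normr_ge0 h.
- exact: cvg_cst.
- rewrite -[0](mulr0 C); apply: cvgMr; apply: cvg_expr; by rewrite ger0_norm.
Qed.

Lemma even_odd_cvg u (l : R) :
  (fun m => u m.*2) @ \oo --> l -> (fun m => u m.*2.+1) @ \oo --> l ->
  u @ \oo --> l.
Proof.
move=> /cvgrPdist_le ue /cvgrPdist_le uo; apply/cvgrPdist_le => e e0.
have [N1 _ h1] := ue e e0; have [N2 _ h2] := uo e e0.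
exists (maxn N1 N2).*2 => // n /= nN.
have hn : (maxn N1 N2 <= n./2)%N by rewrite -[leqLHS]doubleK half_leq.
rewrite -(odd_double_half n); case: (odd n); rewrite ?add1n ?add0n.
  by apply: h2 => /=; apply: leq_trans hn; exact: leq_maxr.
by apply: h1 => /=; apply: leq_trans hn; exact: leq_maxl.
Qed.
End Sequences.

(** * Convergence of the iterated kernel, and tightness *)

Section Ergodic.
Context {R : realType} (a b lambda : R) (lambda_gt0 : 0 < lambda).
Local Notation step := (step a b lambda).
Local Notation step2 := (fun f => step (step f)).
Implicit Types f g : nat -> nat -> R.

Context (V : nat -> nat -> R) (H gam K : R).
Hypothesis gam01 : 0 <= gam < 1.
Hypothesis V_ge : forall x y, x%:R + y%:R <= V x y.
Hypothesis V_le : forall x y, V x y <= H * (x%:R + y%:R).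
Hypothesis drift : forall x y, step V x y <= gam * V x y + K.

Let V0 : forall x y, 0 <= V x y := lyapunov_ge0 V_ge.
Let lV : linear2 V := linear2_lyapunov V_ge V_le.

Lemma linear2_iter_step2 n f : linear2 f -> linear2 (iter n step2 f).
Proof. by move=> lf; elim: n => //= n IH; do 2 apply: (linear2_step _ _ lambda_gt0). Qed.

Lemma iter_step_double n f : iter n.*2 step f = iter n step2 f.
Proof. by elim: n => [//|n IH]; rewrite doubleS !iterS IH. Qed.

Lemma iter_step2_comm n f : step (iter n step2 f) = iter n step2 (step f).
Proof. by elim: n => [//|n IH]; rewrite !iterS IH. Qed.

Lemma step_bounded_by f (A : R) : (forall x y, `|f x y| <= A) ->
  forall x y, `|step f x y| <= A.
Proof.
move=> fA x y; have lf : linear2 f by apply: bounded2_linear2; exists A.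
rewrite ler_norml -[X in X <= _ <= _](step_cst a b lambda _ x y).
rewrite -[X in _ <= _ <= X](step_cst a b lambda _ x y).
by apply/andP; split; apply: le_step => //; try exact: linear2_cst;
  move=> u v; have := fA u v; rewrite ler_norml => /andP[].
Qed.

Section Contraction.
Context (be al : R).
Hypothesis be0 : 0 < be.
Hypothesis al01 : 0 <= al < 1.
Hypothesis contr : forall f (M : R), linear2 f -> 0 <= M ->
    (forall x y x' y', f x y - f x' y' <= M * (2 + be * V x y + be * V x' y')) ->
  forall x y x' y', step2 f x y - step2 f x' y' <=
    al * M * (2 + be * V x y + be * V x' y').

Let al0 : 0 <= al. Proof. by case/andP: al01. Qed.

Lemma iter_step2_gap f (A : R) m x y x' y' : (forall x y, `|f x y| <= A) ->
  iter m step2 f x y - iter m step2 f x' y' <=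
  A * al ^+ m * (2 + be * V x y + be * V x' y').
Proof.
move=> fA; have A0 : 0 <= A by exact: le_trans (fA 0%N 0%N).
have lf : linear2 f by apply: bounded2_linear2; exists A.
elim: m x y x' y' => [|m IH] x y x' y'.
  have p : 0 <= A * (be * V x y + be * V x' y').
    by rewrite mulr_ge0// addr_ge0// mulr_ge0// ltW.
  have := fA x y; have := fA x' y'; rewrite !ler_norml expr0 mulr1 /=.
  move=> /andP[h1 h2] /andP[h3 h4]; rewrite -addrA mulrDr.
  by apply: (@le_trans _ _ (A * 2)); [lra|rewrite lerDl].
rewrite exprS mulrCA; apply: (contr (linear2_iter_step2 m lf)) => //.
by rewrite mulr_ge0// exprn_ge0.
Qed.

Lemma iter_step2_dist f (A : R) m x y x' y' : (forall x y, `|f x y| <= A) ->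
  `|iter m step2 f x y - iter m step2 f x' y'| <=
  A * (2 + be * V x y + be * V x' y') * al ^+ m.
Proof.
move=> fA; rewrite mulrAC ler_norml lerNl opprB; apply/andP; split.
  by rewrite addrAC; apply: iter_step2_gap.
exact: iter_step2_gap.
Qed.

(** Averaging [iter_step2_dist] over the state reached in one step turns its weight [V] into
    [step V]. This bound makes the iterates a Cauchy sequence and compares odd times with even
    ones. *)
Lemma iter_step2_increment f (A : R) m x y : (forall x y, `|f x y| <= A) ->
  `|step (iter m step2 f) x y - iter m step2 f x y| <=
  A * (2 + be * V x y + be * step V x y) * al ^+ m.
Proof.
move=> fA; have A0 : 0 <= A by exact: le_trans (fA 0%N 0%N).
have lf : linear2 f by apply: bounded2_linear2; exists A.
have lg := linear2_iter_step2 m lf.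
set g := iter m step2 f in lg *.
pose D := A * al ^+ m.
(* The sign [c = 1] or [c = -1] treats both sides of the absolute value at once. *)
have sided (c : R) : `|c| = 1 ->
    c * (step g x y - g x y) <= D * (2 + be * V x y + be * step V x y).
  move=> c1.
  have -> : D * (2 + be * V x y + be * step V x y) =
      (D * be) * step V x y + 0 * step V x y + D * (2 + be * V x y) by ring.
  have -> : c * (step g x y - g x y) =
     c * step g x y + 0 * step g x y + (- (c * g x y)) by ring.
  rewrite -!step_combination//; apply: le_step.
  - exact: linear2_combination.
  - exact: linear2_combination.
  move=> u v; rewrite !mul0r !addr0 -mulrBr.
  apply: (le_trans (ler_norm _)); rewrite normrM c1 mul1r.
  apply: (le_trans (iter_step2_dist m u v x y fA)).
  by rewrite /D le_eqVlt; apply/orP; left; apply/eqP; ring.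
rewrite mulrAC -/D ler_norml.
have := sided 1; have := sided (-1); rewrite normrN normr1.
move=> /(_ erefl) h1 /(_ erefl) h2; rewrite mul1r in h2; rewrite h2 andbT.
by rewrite lerNl -mulN1r.
Qed.

Lemma iter_step2_cvg f : bounded2 f ->
  exists l : R, forall x y, iter m step2 f x y @[m --> \oo] --> l.
Proof.
move=> [A fA].
have c0 : cvgn (fun m => iter m step2 f 0%N 0%N).
  pose c := A * (2 + be * V 0%N 0%N + be * step V 0 0).
  apply: (@geometric_increments_cvg _ _ (2 * c) al) => // m.
  (* A double step is split into two single ones: the bound is applied to [f] and to [step f], which
     has the same bound [A]. *)
  have h1 := iter_step2_increment m 0 0 fA.
  have h2 := iter_step2_increment m 0 0 (step_bounded_by fA).
  rewrite -iter_step2_comm in h2.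
  have -> : iter m.+1 step2 f 0%N 0%N - iter m step2 f 0%N 0%N =
    (step (step (iter m step2 f)) 0%N 0%N - step (iter m step2 f) 0%N 0%N) +
    (step (iter m step2 f) 0%N 0%N - iter m step2 f 0%N 0%N) by rewrite addrA subrK.
  apply: (le_trans (ler_normD _ _)).
  by rewrite mulr_natl mulr2n mulrDl lerD.
exists (limn (fun m => iter m step2 f 0%N 0%N)) => x y.
apply: (geometric_dist_cvg al01 _ c0) => m.
exact: iter_step2_dist.
Qed.

End Contraction.

Lemma iter_step_cvg f : bounded2 f ->
  exists l : R, forall x y, iter n step f x y @[n --> \oo] --> l.
Proof.
move=> bf.
have [be [al [be0 al01 contr]]] :=
  step2_contraction lambda_gt0 gam01 V_ge V_le drift.
have [l hl] := iter_step2_cvg be0 al01 contr bf.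
exists l => x y; apply: even_odd_cvg.
  by under eq_fun do rewrite iter_step_double; exact: hl.
have [A fA] := bf.
apply: (@geometric_dist_cvg _ (fun m => iter m step2 f x y) _
   (A * (2 + be * V x y + be * step V x y)) al) => // m.
by rewrite iterS iter_step_double; exact: iter_step2_increment.
Qed.

(* Markov's inequality for [V], uniformly in the number of steps *)
Lemma iter_step_tail (J : nat) n : (0 < J)%N ->
  iter n step (fun _ y => (J <= y)%N%:R) 0%N 0%N <= K / (1 - gam) / J%:R.
Proof.
move=> J0; have /andP[g0 g1] := gam01.
have K0 := drift_cst_ge0 V_ge V_le drift.
(* The fixed point of [t -> gam * t + K], towards which the iterated drift inequality pulls the mean
   of [V]. *)
pose B := K / (1 - gam).
have gap0 : 0 < 1 - gam by rewrite subr_gt0.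
have B0 : 0 <= B by rewrite divr_ge0// ltW.
have KB : K = B * (1 - gam) by rewrite /B divfK// gt_eqF.
have J0' : 0 < J%:R :> R by rewrite ltr0n.
have iterV x y : iter n step V x y <= gam ^+ n * V x y + B * (1 - gam ^+ n).
  elim: n x y => [|m IH] x y; first by rewrite expr0 mul1r subrr mulr0 addr0.
  rewrite iterS.
  apply: (@le_trans _ _ (step (fun x y => gam ^+ m * V x y + 0 * V x y +
      B * (1 - gam ^+ m)) x y)).
    apply: le_step; first exact: linear2_iter_step.
      exact: linear2_combination.
    by move=> u v; rewrite mul0r addr0.
  rewrite step_combination// mul0r addr0.
  have h : gam ^+ m * step V x y <= gam ^+ m * (gam * V x y + K).
    by rewrite ler_wpM2l// exprn_ge0.
  rewrite -lerBrDr; apply: (le_trans h); rewrite KB exprS.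
  by rewrite le_eqVlt; apply/orP; left; apply/eqP; ring.
have lt : linear2 (fun _ y : nat => (J <= y)%N%:R : R).
  apply: bounded2_linear2; exists 1 => _ y.
  by rewrite ger0_norm// lern1 leq_b1.
have tailV m x y : iter m step (fun _ y => (J <= y)%N%:R) x y <=
    J%:R^-1 * iter m step V x y.
  elim: m x y => [|m IH] x y.
    rewrite /= mulrC ler_pdivlMr//; apply: le_trans (V_ge x y).
    case: leqP => Jy; last by rewrite mul0r addr_ge0.
    rewrite mul1r; apply: (@le_trans _ _ y%:R); first by rewrite ler_nat.
    by rewrite lerDr.
  rewrite !iterS.
  have l2 := linear2_iter_step a b lambda_gt0 m lV.
  have -> : J%:R^-1 * step (iter m step V) x y =
      J%:R^-1 * step (iter m step V) x y + 0 * step (iter m step V) x y + 0 by ring.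
  rewrite -step_combination//; apply: le_step; first exact: linear2_iter_step.
    exact: linear2_combination.
  by move=> u v; rewrite mul0r !addr0.
apply: (le_trans (tailV n 0%N 0%N)); rewrite mulrC ler_wpM2r ?invr_ge0//.
apply: (le_trans (iterV 0%N 0%N)); rewrite (lyapunov00 V_ge V_le) mulr0 add0r.
by rewrite ler_piMr// gerBl exprn_ge0.
Qed.

End Ergodic.

Lemma discrete_probability (R : realType) (m : nat -> R) :
    (forall k, 0 <= m k) -> (\sum_(0 <= k <oo) (m k)%:E = 1)%E ->
  exists mu : probability nat R, forall k, mu [set k] = (m k)%:E.
Proof.
move=> m0 m1.
pose atom k : {measure set nat -> \bar R} := mscale (NngNum (m0 k)) \d_k.
pose nu : {measure set nat -> \bar R} := mseries atom 0.
have atomE k A : atom k A = ((m k)%:E * \d_k A)%E by [].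
have nuT : nu setT = 1%E.
  by rewrite -m1; apply: eq_eseriesr => k _; rewrite atomE diracT mule1.
pose mu : probability nat R := HB.pack (Measure.sort nu)
  (Measure_isProbability.Build _ _ _ (Measure.sort nu) nuT).
exists mu => k; rewrite -[LHS]/(\sum_(0 <= i <oo) atom i [set k])%E.
rewrite (@nneseriesD1 _ _ k)// eseries0 => [|i _ /= ik].
  by rewrite adde0 atomE diracE mem_set// mule1.
by rewrite atomE diracE memNset ?mule0// => /= ki; rewrite ki eqxx in ik.
Qed.

(** * The limit functional is a probability measure *)

Section Limit.
Context {R : realType} (a b lambda : R) (lambda_gt0 : 0 < lambda).
Local Notation step := (step a b lambda).
Hypothesis iter_cvg : forall f, bounded2 f ->
  exists l : R, forall x y, iter n step f x y @[n --> \oo] --> l.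
Hypothesis tight : exists B : R, forall J n, (0 < J)%N ->
  iter n step (fun _ y => (J <= y)%N%:R) 0%N 0%N <= B / J%:R.
Implicit Types f g : nat -> R.

Let snd2 f (x y : nat) := f y.

Let bounded f := exists A : R, forall y, `|f y| <= A.

Let bounded_snd2 f : bounded f -> bounded2 (snd2 f).
Proof. by move=> [A fA]; exists A. Qed.

(** For bounded [f], [iter_cvg] ensures that the limit exists and is the same from every starting
    point; (0, 0) is the point at which tightness is known. *)
Let limit f : R := limn (fun n => iter n step (snd2 f) 0%N 0%N).

Let limit_cvg f x y : bounded f -> iter n step (snd2 f) x y @[n --> \oo] --> limit f.
Proof.
move=> /bounded_snd2/iter_cvg[l hl].
by rewrite (_ : limit f = l)//; apply: cvg_lim => //; exact: hl.
Qed.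

Let bounded_comb (p q : R) f g : bounded f -> bounded g ->
  bounded (fun y => p * f y + q * g y).
Proof.
move=> [A fA] [B gB]; exists (`|p| * A + `|q| * B) => y.
by rewrite (le_trans (ler_normD _ _))// !normrM lerD// ler_wpM2l.
Qed.

Let limit_comb (p q : R) f g : bounded f -> bounded g ->
  limit (fun y => p * f y + q * g y) = p * limit f + q * limit g.
Proof.
move=> bf bg; apply: cvg_lim => //.
have lf := bounded2_linear2 (bounded_snd2 bf).
have lg := bounded2_linear2 (bounded_snd2 bg).
have iterE n x y : iter n step (snd2 (fun y => p * f y + q * g y)) x y =
    p * iter n step (snd2 f) x y + q * iter n step (snd2 g) x y.
  elim: n x y => [//|n IH] x y; rewrite !iterS.
  have -> : iter n step (snd2 (fun y => p * f y + q * g y)) =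
      (fun x y => p * iter n step (snd2 f) x y + q * iter n step (snd2 g) x y + 0).
    by apply/funext => u; apply/funext => v; rewrite IH addr0.
  by rewrite step_combination ?addr0//; exact: linear2_iter_step.
under eq_fun do rewrite iterE.
by apply: cvgD; apply: cvgMr; exact: limit_cvg.
Qed.

Let le_limit f g : bounded f -> bounded g -> (forall y, f y <= g y) ->
  limit f <= limit g.
Proof.
move=> bf bg fg; apply: ler_lim.
- by apply/cvg_ex; exists (limit f); exact: limit_cvg.
- by apply/cvg_ex; exists (limit g); exact: limit_cvg.
have lf := bounded2_linear2 (bounded_snd2 bf).
have lg := bounded2_linear2 (bounded_snd2 bg).
suff le_iter n x y : iter n step (snd2 f) x y <= iter n step (snd2 g) x y.
  by apply: nearW => n; exact: le_iter.
elim: n x y => [|n IH] x y; first exact: fg.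
rewrite !iterS; apply: le_step; last exact: IH;
  exact: (linear2_iter_step a b lambda_gt0).
Qed.

Let limit_cst c : limit (fun=> c) = c.
Proof.
have iterE n x y : iter n step (snd2 (fun=> c)) x y = c; last first.
  apply: cvg_lim => //; under eq_fun do rewrite iterE; exact: cvg_cst.
elim: n x y => [//|n IH] x y; rewrite iterS.
rewrite -[RHS](step_cst a b lambda c x y); congr (step _ x y).
by apply/funext => u; apply/funext => v.
Qed.

Let bounded_bool (p : pred nat) : bounded (fun y => (p y)%:R).
Proof. by exists 1 => y; rewrite ger0_norm// lern1 leq_b1. Qed.

Let mass k : R := limit (fun y => (y == k)%:R).

Let limit_sum f J : bounded (fun y => \sum_(k < J) f k * (y == k :> nat)%:R) /\
  limit (fun y => \sum_(k < J) f k * (y == k :> nat)%:R) = \sum_(k < J) f k * mass k.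
Proof.
elim: J => [|J [IH1 IH2]].
  have -> : (fun y => \sum_(k < 0) f k * (y == k :> nat)%:R) = (fun=> 0).
    by apply/funext => y; rewrite big_ord0.
  by rewrite big_ord0 limit_cst; split => //; exists 0 => y; rewrite normr0.
have -> : (fun y => \sum_(k < J.+1) f k * (y == k :> nat)%:R) =
   (fun y => 1 * (\sum_(k < J) f k * (y == k :> nat)%:R) + f J * (y == J)%:R).
  by apply/funext => y; rewrite big_ord_recr mul1r.
split; first exact: bounded_comb.
by rewrite limit_comb// IH2 mul1r big_ord_recr.
Qed.

(** Countable additivity of the limit. Truncating [f] to arguments below [J] changes it by at most
    [A] times the indicator of [J <= y], and tightness bounds the limit of that indicator by
    [B / J]. *)
Let series_mass f (A : R) : (forall y, 0 <= f y <= A) ->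
  (\sum_(0 <= k <oo) (f k * mass k)%:E = (limit f)%:E)%E.
Proof.
move=> fA.
have A0 : 0 <= A by have /andP[h1 h2] := fA 0%N; exact: le_trans h2.
have bf : bounded f.
  by exists A => y; have /andP[h1 h2] := fA y; rewrite ger0_norm.
have [B hB] := tight.
have tailE J (y : nat) : f y - \sum_(k < J) f k * (y == k :> nat)%:R =
    f y * (J <= y)%N%:R.
  case: leqP => Jy.
    rewrite mulr1 big1 ?subr0// => k _; rewrite (_ : (_ == _) = false) ?mulr0//.
    by apply/negbTE; rewrite neq_ltn (leq_trans (ltn_ord k) Jy) orbT.
  rewrite mulr0 (bigD1 (Ordinal Jy))//= eqxx mulr1 big1 ?addr0 ?subrr// => k kJ.
  rewrite (_ : (_ == _) = false) ?mulr0//; apply: contraNF kJ => /eqP yk.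
  by apply/eqP/val_inj.
have gapE J : limit f - \sum_(k < J) f k * mass k = limit (fun y => f y * (J <= y)%N%:R).
  have [h1 h2] := limit_sum f J.
  have := limit_comb 1 (-1) bf h1; rewrite mul1r mulN1r h2 => <-.
  by congr limit; apply/funext => y; rewrite mul1r mulN1r tailE.
have bt J : bounded (fun y => f y * (J <= y)%N%:R).
  exists A => y; have /andP[h1 h2] := fA y.
  rewrite ger0_norm; last by rewrite mulr_ge0.
  by case: leqP; rewrite ?mulr1 ?mulr0.
have gap0 J : 0 <= limit f - \sum_(k < J) f k * mass k.
  rewrite gapE -[X in X <= _](limit_cst 0); apply: le_limit => //.
    by exists 0 => y; rewrite normr0.
  by move=> y; have /andP[h1 _] := fA y; rewrite mulr_ge0.
have gap1 J : limit f - \sum_(k < J.+1) f k * mass k <= A * B * harmonic J.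
  rewrite gapE; apply: (@le_trans _ _ (A * limit (fun y => (J.+1 <= y)%N%:R))).
    have h := bounded_bool (leq J.+1).
    have := limit_comb A 0 h h; rewrite mul0r addr0 => <-.
    apply: le_limit => //; first exact: bounded_comb.
    move=> y; rewrite mul0r addr0 ler_wpM2r//.
    by have /andP[] := fA y.
  rewrite -mulrA ler_wpM2l//.
  have c := limit_cvg 0 0 (bounded_bool (leq J.+1)).
  rewrite -(cvg_lim (@Rhausdorff R) c); apply: limr_le; first by apply/cvg_ex; eexists; exact: c.
  by apply: nearW => n; exact: hB.
apply: cvg_lim => //; apply/cvg_EFin.
  by apply: nearW => n; rewrite sumEFin.
(* The shift matches partial sums of length [J.+1] with [harmonic J], the inverse of [J.+1]. *)
rewrite -(cvg_shiftS _).
apply: (@squeeze_cvgr _ _ _ _ (fun J => limit f - A * B * harmonic J) (fun=> limit f)).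
- apply: nearW => J /=; rewrite sumEFin/= big_mkord.
  by have := gap0 J.+1; have := gap1 J; rewrite subr_ge0 => h1 ->; rewrite andbT lerBlDl -lerBlDr.
- rewrite -[X in _ --> X]subr0; apply: cvgB; first exact: cvg_cst.
  by rewrite -[0](mulr0 (A * B)); apply: cvgMr; exact: cvg_harmonic.
- exact: cvg_cst.
Qed.

(** [series_mass] with the constant 1 gives total mass 1. With [f + A], which is nonnegative, it
    identifies the integral with the limit, and the constant is subtracted afterwards. *)
Lemma limit_probability : exists mu : probability nat R,
  forall f, (exists A : R, forall y, `|f y| <= A) ->
  forall x y, (iter n step (fun _ => f) x y)%:E @[n --> \oo] --> (\int[mu]_k (f k)%:E)%E.
Proof.
have mass0 k : 0 <= mass k.
  rewrite -(limit_cst 0); apply: le_limit => //.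
  by exists 0 => y; rewrite normr0.
have mass1 : (\sum_(0 <= k <oo) (mass k)%:E = 1)%E.
  have := @series_mass (fun=> 1) 1; rewrite limit_cst => <-.
    by apply: eq_eseriesr => k _; rewrite mul1r.
  by move=> y; rewrite ler01 lexx.
have [mu muE] := discrete_probability mass0 mass1.
exists mu => f [A fA] x y.
have bf : bounded f by exists A.
have A0 : 0 <= A by exact: le_trans (fA 0%N).
suff -> : (\int[mu]_k (f k)%:E = (limit f)%:E)%E.
  by apply: cvg_EFin; [exact: nearW|exact: limit_cvg].
have bA : bounded (fun=> 1 : R) by exists 1 => ?; rewrite normr1.
have pos k : 0 <= f k + A <= 2 * A.
  by have := fA k; rewrite ler_norml => /andP[h1 h2]; apply/andP; split; lra.
have h : (\int[mu]_k (f k + A)%:E = (limit f + A)%:E)%E.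
  rewrite ge0_integral_nat; last by move=> k; rewrite lee_fin; case/andP: (pos k).
  have := series_mass pos.
  have -> : limit (fun y => f y + A) = limit f + A.
    have := limit_comb 1 A bf bA; rewrite limit_cst mulr1 mul1r => <-.
    by congr limit; apply/funext => k; rewrite mul1r.
  move=> <-; apply: eq_eseriesr => k _; rewrite mulrC EFinM; congr (_ * _)%E.
  exact: muE.
have intc c : mu.-integrable setT (EFin \o cst c).
  exact: finite_measure_integrable_cst.
have intf : mu.-integrable setT (EFin \o f).
  apply: (@le_integrable _ _ _ _ _ _ _ (EFin \o cst A)) => //.
  by move=> k _ /=; rewrite lee_fin (le_trans (fA k))// ler_norm.
move: h; under eq_integral do rewrite EFinD.
rewrite integralD//=; last exact: (intc A).
rewrite integral_cst// [X in (_ * X)%E](_ : _ = 1%E); last exact: probability_setT.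
rewrite mule1 EFinD.
by move=> /(congr1 (fun z => z - A%:E)%E); rewrite !addeK.
Qed.

End Limit.

(** * From the kernel to the process *)

Section Recurrence.
Context {R : realType} (a b lambda : R) (lambda_gt0 : 0 < lambda).
Context d (T : measurableType d) (P : probability T R) (X : nat -> {RV P >-> nat}).
Hypothesis HX : is_poisson_autoregression P a b lambda X.
Local Notation step := (step a b lambda).

Lemma pair_mean_iter n f : bounded2 f ->
  pair_mean X n f = pair_mean X 0 (iter n step f).
Proof.
elim: n f => [//|n IH] f bf.
apply: (etrans (pair_meanS HX n bf)); rewrite iterSr.
by apply: IH; exact: bounded2_step.
Qed.

(** By the Markov property the mean at time [n] is that of the [n]-th iterate at the random initial
    pair; all iterates share the bound [A], so convergence from each fixed pair passes through the
    integral. *)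
Lemma integral_pair_cvg (f : nat -> nat -> R) (l : \bar R) : bounded2 f ->
    (forall x y, (iter n step f x y)%:E @[n --> \oo] --> l) ->
  (\int[P]_w (f (X n w) (X n.+1 w))%:E)%E @[n --> \oo] --> l.
Proof.
move=> bf fl; have [A fA] := bf.
have iterA n x y : `|iter n step f x y| <= A.
  by elim: n x y => [//|n IH] x y; rewrite iterS; exact: step_bounded_by.
have biter n : bounded2 (iter n step f) by exists A.
have E n : (\int[P]_w (f (X n w) (X n.+1 w))%:E =
    \int[P]_w (iter n step f (X 0%N w) (X 1%N w))%:E)%E.
  rewrite -[LHS]fineK; last first.
    by apply: integrable_fin_num => //; exact: (bounded2_integrable X n bf).
  rewrite -[RHS]fineK; last first.
    by apply: integrable_fin_num => //; exact: (bounded2_integrable X 0 (biter n)).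
  by congr EFin; exact: pair_mean_iter.
have -> : l = (\int[P]_w cst l w)%E.
  rewrite integral_cst// [X in (_ * X)%E](_ : _ = 1%E) ?mule1//.
  exact: probability_setT.
under eq_fun do rewrite E.
have [|||||_ _] := @dominated_convergence _ _ _ P setT measurableT
  (fun n w => (iter n step f (X 0%N w) (X 1%N w))%:E) (cst l) (cst A%:E).
- by move=> n; exact: (measurable_fun_fibers2 (fun x y => (iter n step f x y)%:E)).
- exact: measurable_cst.
- by apply: nearW => w _; exact: fl.
- exact: (@finite_measure_integrable_cst _ _ _ P).
- by apply: nearW => w n _; rewrite /= lee_fin.
by [].
Qed.

Lemma region_R_cvg_in_law : region_R (a, b) -> cvg_in_law P (fun n => X n.+1).
Proof.
move=> /region_R_contracts/(lyapunov_function lambda_gt0).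
move=> [V [H [gam [K [gam01 V_ge V_le drift]]]]].
have [|mu hmu] := @limit_probability R a b lambda lambda_gt0
  (iter_step_cvg lambda_gt0 gam01 V_ge V_le drift).
  exists (K / (1 - gam)) => J n J0.
  exact: (iter_step_tail lambda_gt0 gam01 V_ge V_le drift).
exists mu => f _ [M [_ fM]].
have fA : exists A : R, forall y, `|f y| <= A.
  by exists (M + 1) => y; apply: (fM (M + 1) _ y I); rewrite ltrDl.
have bf : bounded2 (fun _ => f) by have [A hA] := fA; exists A.
have := integral_pair_cvg bf (hmu f fA).
by apply: cvg_trans; apply: near_eq_cvg; apply: nearW => n; rewrite unlock.
Qed.

End Recurrence.

Theorem theorem1 (R : realType) (d : measure_display) (T : measurableType d)
    (P : probability T R) (a b lambda : R) (X : nat -> {RV P >-> nat})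
    (lambda_gt0 : 0 < lambda)
    (HX : is_poisson_autoregression P a b lambda X) :
  (region_R (a, b) -> cvg_in_law P (fun n => X n.+1)) /\
  (region_T (a, b) ->
   {ae P, forall w, (X n.+1 w + X n.+2 w)%N @[n --> \oo] --> \oo}).
Proof.
split; first exact: (region_R_cvg_in_law lambda_gt0 HX).
move=> /(region_T_superharmonic lambda_gt0)[g [bg sg sg0]].
exact: (superharmonic_transience HX bg sg sg0).
Qed.
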